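(* Let $0<\alpha<1$ and consider the Robertson-Walker cosmology with scale factor $a(t)=t^{\alpha}$. Let $\tau>0$, let $v=\alpha\chi/\tau^{1-\alpha}$, and suppose $0<v<\frac{\alpha}{1-\alpha}C_\alpha$. Then the kinematic and Fermi speeds of the comoving test particle with fixed coordinate $\chi$, relative to the comoving central observer $\beta$ at proper time $\tau$, are given by $$\|v_{\mathrm{kin}}\|=\sqrt{1-\frac{t_{\mathrm s}^{2\alpha}}{\tau^{2\alpha}}}=\sqrt{1-G_\alpha^{2\alpha}(v)},$$ $$\|v_{\mathrm{Fermi}}\|=G_\alpha^{1-\alpha}(v)\sqrt{1-G_\alpha^{2\alpha}(v)}+\frac{1-\alpha}{\alpha}\left(1-G_\alpha^{2\alpha}(v)\right)v=\frac{\rho}{\tau}-\frac{1-\alpha}{\alpha}\,G_\alpha^{2\alpha}(v)\,v .$$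
   Context: For radial motion one works in the two-dimensional spacetime with coordinates $(t,\chi)$, $t>0$, and metric $ds^2=-dt^2+a^2(t)\,d\chi^2$. The central observer is $\beta(\tau)=(\tau,0)$, with 4-velocity $u=\partial/\partial t$; at $p=(\tau,0)$ put $\mathcal S_p=\frac{1}{a(\tau)}\frac{\partial}{\partial\chi}\big|_p$ (a unit vector). A comoving test particle is the curve $\beta'(\tau')=(\tau',\chi)$ with $\chi>0$ constant. Constants and functions: $$C_\alpha:=\frac{\sqrt\pi\,\Gamma\left(\frac{1+\alpha}{2\alpha}\right)}{\Gamma\left(\frac1{2\alpha}\right)},\qquad F_\alpha(z):=z^{\frac{1-\alpha}{\alpha}}\,{}_2F_1\left(\tfrac12,\tfrac{1-\alpha}{2\alpha};\tfrac{1+\alpha}{2\alpha};z^2\right)\quad(0<z<1),$$ where ${}_2F_1$ is the Gauss hypergeometric function; $F_\alpha$ is a bijection from $(0,1)$ onto $(0,C_\alpha)$, with inverse $F_\alpha^{-1}$, and $$G_\alpha(v):=\left(F_\alpha^{-1}\left(C_\alpha-\tfrac{1-\alpha}{\alpha}v\right)\right)^{1/\alpha},\qquad 0<v<\tfrac{\alpha}{1-\alpha}C_\alpha .$$ The event $q_{\mathrm s}=(t_{\mathrm s},\chi)$, with $t_{\mathrm s}=t_{\mathrm s}(\tau,\chi)<\tau$, is the event of the test particle lying on the spacelike geodesic that starts at $p=(\tau,0)$ with initial velocity $\mathcal S_p$ (orthogonal to $u$); equivalently $\int_{t_{\mathrm s}}^{\tau}\frac{a(\tau)}{a(\bar\tau)}\frac{d\bar\tau}{\sqrt{a^2(\tau)-a^2(\bar\tau)}}=\chi$.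 The condition $0<v<\frac{\alpha}{1-\alpha}C_\alpha$ is exactly the condition that such an event with $t_{\mathrm s}>0$ exists. The Fermi distance $\rho=\rho(\tau,\chi)$ is the proper length of that geodesic from $p$ to $q_{\mathrm s}$: $\rho=\int_{t_{\mathrm s}}^{\tau}\frac{a(\bar\tau)}{\sqrt{a^2(\tau)-a^2(\bar\tau)}}\,d\bar\tau$. Fermi relative velocity of the comoving particle at $p$: $v_{\mathrm{Fermi}}=\frac{\partial\rho(\tau,\chi)}{\partial\tau}\mathcal S_p$ ($\chi$ fixed). Kinematic relative velocity: letting $w$ be the parallel transport of the particle's 4-velocity $\partial/\partial t|_{q_{\mathrm s}}$ to $p$ along the geodesic above, $v_{\mathrm{kin}}$ is the unique vector at $p$ orthogonal to $u$ with $w=\gamma(u+v_{\mathrm{kin}})$ for some scalar $\gamma$. *)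

(* Defs.v *)
From Stdlib Require Import Reals Factorial ClassicalEpsilon.
From Coquelicot Require Import Coquelicot.
Open Scope R_scope.

(* Definite description: unspecified unless exactly one [x] satisfies [P]. *)
Definition the {A : Type} (d : A) (P : A -> Prop) : A :=
  epsilon (inhabits d) (unique P).

(** * Special functions *)

Definition Gamma (x : R) : R :=
  RInt_gen (fun t => Rpower t (x - 1) * exp (- t))
           (at_right 0) (Rbar_locally p_infty).

Fixpoint pochhammer (x : R) (n : nat) : R :=
  match n with
  | O => 1
  | S m => pochhammer x m * (x + INR m)
  end.

Definition hyp2F1 (a b c z : R) : R :=
  PSeries (fun n => pochhammer a n * pochhammer b n
                    / (pochhammer c n * INR (fact n))) z.

Definition Calpha (alpha : R) : R :=
  sqrt PI * Gamma ((1 + alpha) / (2 * alpha)) / Gamma (1 / (2 * alpha)).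

Definition Falpha (alpha z : R) : R :=
  Rpower z ((1 - alpha) / alpha)
  * hyp2F1 (1 / 2) ((1 - alpha) / (2 * alpha)) ((1 + alpha) / (2 * alpha)) (z ^ 2).

Definition Falpha_inv (alpha y : R) : R :=
  the 0 (fun z => 0 < z < 1 /\ Falpha alpha z = y).

Definition Galpha (alpha v : R) : R :=
  Rpower (Falpha_inv alpha (Calpha alpha - (1 - alpha) / alpha * v)) (1 / alpha).

(** * The spacetime [ds^2 = - dt^2 + a(t)^2 dchi^2] on [t > 0]

    Events are pairs [(t, chi)]; tangent vectors are pairs of components in
    the coordinate basis [(d/dt, d/dchi)]. *)

Definition metric (a : R -> R) (p X Y : R * R) : R :=
  - (fst X * fst Y) + a (fst p) ^ 2 * (snd X * snd Y).

(* Norm of a spacelike vector at [p]. *)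
Definition gnorm (a : R -> R) (p X : R * R) : R := sqrt (metric a p X X).

(* [Gamma^k_{ij} U^i X^j] for the Levi-Civita connection, whose only nonzero
   symbols are Gamma^t_{chi chi} = a a' and
   Gamma^chi_{t chi} = Gamma^chi_{chi t} = a'/a. *)
Definition christoffel (a : R -> R) (p U X : R * R) : R * R :=
  ( a (fst p) * Derive a (fst p) * (snd U * snd X),
    Derive a (fst p) / a (fst p) * (fst U * snd X + snd U * fst X) ).

(* [c] is a curve in the spacetime with velocity [dc] on the parameter
   interval [0, L].  Derivatives at the endpoints are two-sided; since the
   values outside [0, L] are otherwise unconstrained, this amounts to
   one-sided differentiability there. *)
Definition is_curve (L : R) (c dc : R -> R * R) : Prop :=
  forall s, 0 <= s <= L ->
    0 < fst (c s)
    /\ is_derive (fun r => fst (c r)) s (fst (dc s))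
    /\ is_derive (fun r => snd (c r)) s (snd (dc s)).

(* [X' + Gamma(dc, X) = 0] on [0, L]. *)
Definition is_parallel (a : R -> R) (L : R) (c dc X : R -> R * R) : Prop :=
  forall s, 0 <= s <= L ->
    is_derive (fun r => fst (X r)) s (- fst (christoffel a (c s) (dc s) (X s)))
    /\ is_derive (fun r => snd (X r)) s (- snd (christoffel a (c s) (dc s) (X s))).

Definition is_geodesic (a : R -> R) (L : R) (c dc : R -> R * R) : Prop :=
  is_curve L c dc /\ is_parallel a L c dc dc.

Definition proper_length (a : R -> R) (L : R) (c dc : R -> R * R) : R :=
  RInt (fun s => gnorm a (c s) (dc s)) 0 L.

(** * Relative velocities of comoving test particles *)

(* 4-velocity d/dt of the comoving observers, at any event. *)
Definition four_velocity : R * R := (1, 0).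

Definition S_vec (a : R -> R) (tau : R) : R * R := (0, / a tau).

(* Geodesic from [(tau, 0)] with initial velocity [S_vec], reaching at
   parameter [L], before time [tau], the particle with coordinate [chi]. *)
Definition fermi_geodesic (a : R -> R) (tau chi L : R) (c dc : R -> R * R) : Prop :=
  0 <= L /\ is_geodesic a L c dc
  /\ c 0 = (tau, 0) /\ dc 0 = S_vec a tau
  /\ snd (c L) = chi /\ fst (c L) < tau.

Definition t_s (a : R -> R) (tau chi : R) : R :=
  the 0 (fun t => exists L c dc,
    fermi_geodesic a tau chi L c dc /\ t = fst (c L)).

Definition fermi_distance (a : R -> R) (tau chi : R) : R :=
  the 0 (fun r => exists L c dc,
    fermi_geodesic a tau chi L c dc /\ r = proper_length a L c dc).

(* Parallel transport to [(tau, 0)] of the particle's 4-velocity at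
   [(t_s, chi)], along the geodesic joining these events. *)
Definition transported_velocity (a : R -> R) (tau chi : R) : R * R :=
  the (0, 0) (fun w => exists L c dc X,
    fermi_geodesic a tau chi L c dc /\ is_parallel a L c dc X
    /\ X L = four_velocity /\ w = X 0).

Definition v_kin (a : R -> R) (tau chi : R) : R * R :=
  the (0, 0) (fun V =>
    metric a (tau, 0) four_velocity V = 0
    /\ exists gam : R,
         transported_velocity a tau chi = scal gam (plus four_velocity V)).

(* [the] rather than [Derive], so that differentiability of the Fermi
   distance in [tau] is needed for the vector to be specified. *)
Definition v_Fermi (a : R -> R) (tau chi : R) : R * R :=
  the (0, 0) (fun V => exists d : R,
    is_derive (fun tau' => fermi_distance a tau' chi) tau d
    /\ V = scal d (S_vec a tau)).

(* Main.v *)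
(** Along the geodesic put [a t / a tau = cos psi], [0 <= psi < PI / 2].  Then
    [t' = - tan psi], the coordinate [chi] is
    [tau^(1-alpha) / alpha * int_0^psi cos^(1/alpha - 2)], and the arc length is
    [tau / alpha * int_0^psi cos^(1/alpha)].  Along every such geodesic
    [psi = atan (- t')] satisfies [psi' = alpha / t], so these formulas are forced
    by the conserved quantities [a^2 chi'] and [- t'^2 + a^2 chi'^2].

    Expanding [(1 - z^2)^(-1/2)] gives
    [F_alpha (cos psi) = C_alpha - (1-alpha)/alpha * int_0^psi cos^(1/alpha - 2)],
    so the endpoint is [cos psi = G_alpha(v)^alpha].  The constant is the Wallis
    integral [int_0^(PI/2) cos^m], evaluated by Gamma functions through its
    recurrence in [m] and the log-convexity of [Gamma].

    The velocity and its unit normal are parallel, which gives [|v_kin| = sin psi];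
    differentiating the arc length at fixed [chi] gives [v_Fermi]. *)
Require Import Defs.
From Stdlib Require Import Reals Factorial Lra Lia ClassicalEpsilon.
From Coquelicot Require Import Coquelicot.
Open Scope R_scope.

(** Every geometric quantity is a definite description, so each formula needs both a geodesic and a
    proof that all competitors agree. Existence comes from inverting arc length as a function of
    psi. Uniqueness comes from conserved quantities evaluated along an arbitrary competitor, without
    any uniqueness theorem for differential equations. The angle psi is preferred to t because the
    time integrals are singular at the starting point, where [sqrt (a(tau)^2 - a(t)^2)] vanishes,
    whereas the integrals in psi are smooth there. The other end stays delicate: for [alpha > 1/2]
    the exponent [1/alpha - 2] lies in [(-1, 0)], so the integral up to [PI / 2] is improper and
    enters as a limit. That limit is [alpha/(1-alpha) C_alpha], hence the bound on [v] says that an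
    angle below [PI / 2] exists. For the Fermi velocity, fixing chi makes psi a function of tau
    through [int_0^psi cos^(1/alpha - 2) = alpha chi tau^(alpha-1)]. *)

(** * Real powers and improper integrals on the half-line *)

Lemma Rpower_pos (x y : R) : 0 < Rpower x y.
Proof. apply exp_pos. Qed.

Lemma is_derive_Rpower (x y : R) :
  0 < x -> is_derive (fun t => Rpower t y) x (y * Rpower x (y - 1)).
Proof.
  intro Hx. apply is_derive_Reals. now apply derivable_pt_lim_power.
Qed.

Lemma Rpower_minus_1 (x y : R) : 0 < x -> x * Rpower x (y - 1) = Rpower x y.
Proof.
  intro Hx. rewrite <- (Rpower_1 x Hx) at 1. rewrite <- Rpower_plus.
  f_equal; ring.
Qed.

Lemma Rpower_lim_0 (y : R) :
  0 < y -> filterlim (fun t => Rpower t y) (at_right 0) (locally 0).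
Proof.
  intro Hy. apply filterlim_locally. intros [eps Heps]; simpl.
  exists (mkposreal (Rpower eps (/ y)) (Rpower_pos _ _)). intros t Ht H0.
  change (Rabs (t - 0) < Rpower eps (/ y)) in Ht.
  change (Rabs (Rpower t y - 0) < eps).
  rewrite Rminus_0_r in Ht |- *.
  rewrite Rabs_pos_eq in Ht by lra.
  rewrite Rabs_pos_eq by (left; apply Rpower_pos).
  replace eps with (Rpower (Rpower eps (/ y)) y).
  2:{ rewrite Rpower_mult, Rinv_l by lra. now apply Rpower_1. }
  unfold Rpower at 1 2. apply exp_increasing.
  apply Rmult_lt_compat_l; [lra|]. now apply ln_increasing.
Qed.

(** The left side is largest at [x = y]: take [ln q <= q - 1] at [q = x / y] and multiply by [y]. *)
Lemma Rpower_exp_bound (y x : R) :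
  0 < y -> 0 < x -> Rpower x y * exp (- x) <= exp (y * (ln y - 1)).
Proof.
  intros Hy Hx. unfold Rpower. rewrite <- exp_plus.
  assert (H : ln (x / y) <= x / y - 1).
  { assert (Hxy : 0 < x / y) by now apply Rdiv_lt_0_compat.
    generalize (exp_ineq1_le (ln (x / y))). rewrite exp_ln by assumption. lra. }
  rewrite ln_div in H by assumption.
  apply (Rmult_le_compat_l y) in H; [|lra].
  replace (y * (x / y - 1)) with (x - y) in H by (field; lra).
  destruct (Rle_lt_or_eq_dec (y * ln x + - x) (y * (ln y - 1))) as [h|h]; [lra| |].
  - left. now apply exp_increasing.
  - rewrite h. apply Rle_refl.
Qed.

Lemma at_right_0_infty_lt (P : R * R -> Prop) :
  (forall u v, 0 < u < v -> P (u, v)) ->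
  filter_prod (at_right 0) (Rbar_locally p_infty) P.
Proof.
  intro H. apply (Filter_prod _ _ _ (fun u => 0 < u < 1) (fun v => 1 < v)).
  - exists (mkposreal 1 Rlt_0_1). intros u Hu H0.
    change (Rabs (u - 0) < 1) in Hu. apply Rabs_def2 in Hu. lra.
  - now exists 1.
  - intros u v Hu Hv. apply H. lra.
Qed.

(** For a nonnegative integrand the integrals grow with the interval, so their supremum is the
    improper integral. Keeping the comparison with proper integrals in the conclusion later gives
    positivity of [Gamma]. *)
Lemma ex_RInt_gen_bounded (f : R -> R) (M : R) :
  (forall x, 0 < x -> continuous f x) ->
  (forall x, 0 < x -> 0 <= f x) ->
  (forall u v, 0 < u <= v -> RInt f u v <= M) ->
  exists l, is_RInt_gen f (at_right 0) (Rbar_locally p_infty) l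
    /\ forall u v, 0 < u <= v -> RInt f u v <= l.
Proof.
  intros Hc Hp HM.
  assert (Hex : forall u v, 0 < u -> 0 < v -> ex_RInt f u v).
  { intros u v Hu Hv. apply (@ex_RInt_continuous R_CompleteNormedModule).
    intros x Hx. apply Hc. generalize (Rmin_pos u v Hu Hv). lra. }
  assert (Hge : forall u v, 0 < u <= v -> 0 <= RInt f u v).
  { intros u v Huv. apply RInt_ge_0; [lra|apply Hex; lra|]. intros; apply Hp; lra. }
  destruct (completeness (fun y => exists u v, 0 < u <= v /\ y = RInt f u v))
    as [l [Hub Hlub]].
  { exists M. intros y (u & v & Huv & ->). now apply HM. }
  { exists (RInt f 1 1), 1, 1. split; [lra|reflexivity]. }
  exists l. split; [|intros u v Huv; apply Hub; now exists u, v].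
  apply filterlimi_locally. intros [eps Heps].
  assert (exists u v, 0 < u <= v /\ l - eps < RInt f u v)
    as (u0 & v0 & Huv & Hl).
  { apply Classical_Prop.NNPP. intro H.
    assert (l <= l - eps); [|lra]. apply Hlub.
    intros y (u & v & Huv & ->). apply Rnot_lt_le. intro H'.
    apply H. now exists u, v. }
  apply (Filter_prod _ _ _ (fun u => 0 < u < u0) (fun v => v0 < v)).
  - assert (h0 : 0 < u0) by lra. exists (mkposreal _ h0). intros u Hu H0.
    change (Rabs (u - 0) < u0) in Hu. apply Rabs_def2 in Hu. lra.
  - now exists v0.
  - intros u v Hu Hv. exists (RInt f u v). simpl. split.
    + apply (@RInt_correct R_CompleteNormedModule). apply Hex; lra.
    + change (Rabs (RInt f u v - l) < eps).
      assert (RInt f u v <= l) by (apply Hub; exists u, v; split; [lra|auto]).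
      assert (RInt f u0 v0 <= RInt f u v).
      { rewrite <- (RInt_Chasles f u u0 v) by (apply Hex; lra).
        rewrite <- (RInt_Chasles f u0 v0 v) by (apply Hex; lra).
        assert (0 <= RInt f u u0) by (apply Hge; lra).
        assert (0 <= RInt f v0 v) by (apply Hge; lra).
        unfold plus; simpl. lra. }
      apply Rabs_def1; lra.
Qed.

(** Letting [f] dominate itself in the norm inequality yields [|l| <= l]. *)
Lemma is_RInt_gen_ge_0 (f : R -> R) (l : R) :
  (forall x, 0 < x -> 0 <= f x) ->
  is_RInt_gen f (at_right 0) (Rbar_locally p_infty) l -> 0 <= l.
Proof.
  intros Hp Hf. apply (Rle_trans _ (Rabs l)); [apply Rabs_pos|].
  apply (RInt_gen_norm (V := R_CompleteNormedModule)
           (Fa := at_right 0) (Fb := Rbar_locally p_infty) f f); try assumption.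
  - apply at_right_0_infty_lt. simpl. intros; lra.
  - apply at_right_0_infty_lt. simpl. intros u v Huv x Hx.
    change (Rabs (f x) <= f x). rewrite Rabs_pos_eq; [lra|]. apply Hp; lra.
Qed.

Lemma is_RInt_gen_unique_R (f : R -> R) (l1 l2 : R) :
  is_RInt_gen f (at_right 0) (Rbar_locally p_infty) l1 ->
  is_RInt_gen f (at_right 0) (Rbar_locally p_infty) l2 -> l1 = l2.
Proof.
  intros H1 H2.
  rewrite <- (@is_RInt_gen_unique R_CompleteNormedModule _ _ _ _ f l1 H1).
  now apply (@is_RInt_gen_unique R_CompleteNormedModule _ _ _ _ f l2).
Qed.

(** * Euler's Gamma integral *)

Definition Gamma_integrand (s t : R) : R := Rpower t (s - 1) * exp (- t).

Lemma Gamma_integrand_continuous (s t : R) :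
  0 < t -> continuous (Gamma_integrand s) t.
Proof.
  intro Ht. apply (@ex_derive_continuous R_AbsRing R_NormedModule).
  apply (ex_derive_mult (fun t => Rpower t (s - 1)) (fun t => exp (- t))).
  - eexists. now apply is_derive_Rpower.
  - auto_derive. trivial.
Qed.

Lemma Gamma_integrand_pos (s t : R) : 0 < Gamma_integrand s t.
Proof. apply Rmult_lt_0_compat; apply exp_pos. Qed.

(** A single majorant with an explicit antiderivative handles both the possible singularity at 0 and
    the tail, so the half-line is never split. *)
Lemma ex_Gamma (s : R) :
  0 < s ->
  exists l, is_RInt_gen (Gamma_integrand s) (at_right 0) (Rbar_locally p_infty) l
    /\ forall u v, 0 < u <= v -> RInt (Gamma_integrand s) u v <= l.
Proof.
  intro Hs.
  (* [K] bounds [(1+t)^(s+1) e^(-t)]: it is [e] times the maximum of [x^(s+1) e^(-x)], with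
     [x = 1 + t]. *)
  set (K := exp 1 * exp ((s + 1) * (ln (s + 1) - 1))).
  apply (ex_RInt_gen_bounded _ (K / s)).
  - intros; now apply Gamma_integrand_continuous.
  - intros; left; apply Gamma_integrand_pos.
  - intros u v Huv.
    (* [t^(s-1) e^(-t) <= K t^(s-1) / (1+t)^(s+1)], the derivative of
       [(K/s) (t/(1+t))^s]. *)
    set (h := fun t => K / s * Rpower (t / (1 + t)) s).
    set (dh := fun t => K * (Rpower (t / (1 + t)) (s - 1) * / (1 + t) ^ 2)).
    assert (Hq : forall t, 0 < t -> 0 < t / (1 + t)).
    { intros t Ht. apply Rdiv_lt_0_compat; lra. }
    assert (Hd : forall t, 0 < t -> is_derive h t (dh t)).
    { intros t Ht. unfold h, dh.
      evar_last.
      - apply is_derive_scal.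
        apply (is_derive_comp (fun y => Rpower y s) (fun t => t / (1 + t))).
        + now apply is_derive_Rpower, Hq.
        + instantiate (1 := / (1 + t) ^ 2). auto_derive; [lra|]. field. lra.
      - unfold scal; simpl; unfold mult; simpl. field. split; lra. }
    assert (Hdc : forall t, 0 < t -> continuous dh t).
    { intros t Ht. apply (@ex_derive_continuous R_AbsRing R_NormedModule).
      apply ex_derive_scal.
      apply (ex_derive_mult (fun t => Rpower (t / (1 + t)) (s - 1))
               (fun t => / (1 + t) ^ 2)).
      - apply (ex_derive_comp (fun y => Rpower y (s - 1)) (fun t => t / (1 + t))).
        + eexists. now apply is_derive_Rpower, Hq.
        + auto_derive. lra.
      - auto_derive. nra. }
    assert (Hi : is_RInt dh u v (h v - h u)).
    { apply (is_RInt_derive h dh).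
      - intros t Ht. apply Hd. rewrite Rmin_left in Ht; lra.
      - intros t Ht. apply Hdc. rewrite Rmin_left in Ht; lra. }
    apply (Rle_trans _ (RInt dh u v)).
    + apply RInt_le; [lra| |eexists; eassumption|].
      * apply (@ex_RInt_continuous R_CompleteNormedModule). intros t Ht.
        apply Gamma_integrand_continuous. rewrite Rmin_left in Ht; lra.
      * intros t Ht. unfold Gamma_integrand, dh.
        assert (Ht1 : 0 < 1 + t) by lra.
        assert (E : Rpower (t / (1 + t)) (s - 1) * / (1 + t) ^ 2
                    = Rpower t (s - 1) * / Rpower (1 + t) (s + 1)).
        { unfold Rdiv. rewrite <- Rpower_mult_distr; [|lra|now apply Rinv_0_lt_compat].
          rewrite Rmult_assoc. f_equal.
          rewrite <- (Rpower_pow 2) by lra. rewrite <- !Rpower_Ropp.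
          replace (/ (1 + t)) with (Rpower (1 + t) (- (1))).
          2:{ rewrite Rpower_Ropp, Rpower_1 by lra. reflexivity. }
          rewrite Rpower_mult, <- Rpower_plus. f_equal. simpl; ring. }
        rewrite E.
        rewrite (Rmult_comm K), Rmult_assoc.
        apply Rmult_le_compat_l; [left; apply Rpower_pos|].
        apply (Rmult_le_reg_l (Rpower (1 + t) (s + 1))); [apply Rpower_pos|].
        rewrite <- Rmult_assoc, Rinv_r, Rmult_1_l by apply Rgt_not_eq, Rpower_pos.
        replace (exp (- t)) with (exp 1 * exp (- (1 + t))).
        2:{ rewrite <- exp_plus. f_equal. ring. }
        unfold K.
        replace (Rpower (1 + t) (s + 1) * (exp 1 * exp (- (1 + t))))
          with (exp 1 * (Rpower (1 + t) (s + 1) * exp (- (1 + t)))) by ring.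
        apply Rmult_le_compat_l; [left; apply exp_pos|].
        apply Rpower_exp_bound; lra.
    + rewrite (is_RInt_unique _ _ _ _ Hi). unfold h.
      assert (0 < K / s).
      { apply Rdiv_lt_0_compat; [|lra]. apply Rmult_lt_0_compat; apply exp_pos. }
      assert (Hv : v / (1 + v) < 1).
      { apply (Rmult_lt_reg_r (1 + v)); [lra|].
        replace (v / (1 + v) * (1 + v)) with v by (field; lra). lra. }
      apply ln_increasing in Hv; [|apply Hq; lra]. rewrite ln_1 in Hv.
      assert (He : s * ln (v / (1 + v)) < 0) by nra.
      apply exp_increasing in He. rewrite exp_0 in He.
      change (Rpower (v / (1 + v)) s < 1) in He.
      generalize (Rpower_pos (u / (1 + u)) s). nra.
Qed.

Lemma is_RInt_gen_Gamma (s : R) :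
  0 < s ->
  is_RInt_gen (Gamma_integrand s) (at_right 0) (Rbar_locally p_infty) (Gamma s).
Proof.
  intro Hs. destruct (ex_Gamma s Hs) as (l & Hl & _).
  apply (@RInt_gen_correct R_CompleteNormedModule _ _ _ _ (Gamma_integrand s)). now exists l.
Qed.

Lemma Gamma_pos (s : R) : 0 < s -> 0 < Gamma s.
Proof.
  intro Hs. destruct (ex_Gamma s Hs) as (l & Hl & Hle).
  replace (Gamma s) with l.
  2:{ symmetry. now apply (@is_RInt_gen_unique R_CompleteNormedModule _ _ _ _ (Gamma_integrand s)). }
  apply (Rlt_le_trans _ (RInt (Gamma_integrand s) 1 2)); [|apply Hle; lra].
  apply RInt_gt_0; [lra| |].
  - intros; apply Gamma_integrand_pos.
  - intros; apply Gamma_integrand_continuous; lra.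
Qed.

(** Integration by parts: [t^s e^(-t)] vanishes at both ends, so the integral of its derivative is
    0. *)
Lemma Gamma_S (s : R) : 0 < s -> Gamma (s + 1) = s * Gamma s.
Proof.
  intro Hs.
  set (f := fun t => Rpower t s * exp (- t)).
  assert (Hd : forall t, 0 < t ->
    is_derive f t (s * Gamma_integrand s t - Gamma_integrand (s + 1) t)).
  { intros t Ht. unfold f, Gamma_integrand. evar_last.
    - apply (is_derive_mult (fun t => Rpower t s) (fun t => exp (- t))).
      + now apply is_derive_Rpower.
      + instantiate (1 := - exp (- t)). auto_derive; [trivial|ring].
      + intros; apply Rmult_comm.
    - unfold plus, mult; simpl. replace (s + 1 - 1) with s by ring. ring. }
  assert (HD : is_RInt_gen (Derive f) (at_right 0) (Rbar_locally p_infty) (0 - 0)).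
  { apply is_RInt_gen_Derive.
    - apply at_right_0_infty_lt. simpl. intros u v Huv x Hx.
      rewrite Rmin_left in Hx by lra. eexists. apply Hd. lra.
    - apply at_right_0_infty_lt. simpl. intros u v Huv x Hx.
      rewrite Rmin_left in Hx by lra.
      apply (continuous_ext_loc _
        (fun t => s * Gamma_integrand s t - Gamma_integrand (s + 1) t)).
      + assert (Hx0 : 0 < x) by lra. exists (mkposreal _ Hx0). intros y Hy.
        apply Rabs_def2 in Hy; simpl in Hy. symmetry. apply is_derive_unique, Hd.
        unfold minus, plus, opp in Hy; simpl in Hy. lra.
      + apply (continuous_minus (fun t => s * Gamma_integrand s t)).
        * apply (continuous_scal_r s (Gamma_integrand s)).
          apply Gamma_integrand_continuous; lra.
        * apply Gamma_integrand_continuous; lra.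
    - apply (filterlim_le_le (fun _ => 0) f (fun t => Rpower t s) 0).
      + exists (mkposreal 1 Rlt_0_1). intros t _ Ht. unfold f. split.
        * left. apply Rmult_lt_0_compat; apply exp_pos.
        * generalize (Rpower_pos t s).
          assert (exp (- t) < 1) by (rewrite <- exp_0; apply exp_increasing; lra).
          intro. rewrite <- (Rmult_1_r (Rpower t s)) at 2.
          apply Rmult_le_compat_l; lra.
      + apply filterlim_const.
      + now apply Rpower_lim_0.
    (* At infinity the exponential bound with exponent [s + 1] leaves a constant times [1 / t]. *)
    - apply (filterlim_le_le (fun _ => 0) f
               (fun t => exp ((s + 1) * (ln (s + 1) - 1)) * / t) 0).
      + exists 0. intros t Ht. unfold f. split.
        * left. apply Rmult_lt_0_compat; apply exp_pos.
        * apply (Rmult_le_reg_r t); [lra|].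
          replace (exp ((s + 1) * (ln (s + 1) - 1)) * / t * t)
            with (exp ((s + 1) * (ln (s + 1) - 1))) by (field; lra).
          replace (Rpower t s * exp (- t) * t)
            with (Rpower t (s + 1) * exp (- t)).
          2:{ rewrite Rpower_plus, Rpower_1 by lra. ring. }
          apply Rpower_exp_bound; lra.
      + apply filterlim_const.
      + replace (Finite 0) with (Rbar_mult (exp ((s + 1) * (ln (s + 1) - 1))) (Rbar_inv p_infty))
          by (simpl; f_equal; ring).
        apply (is_lim_scal_l Rinv (exp ((s + 1) * (ln (s + 1) - 1))) p_infty).
        apply (is_lim_inv (fun t => t)); [apply is_lim_id|discriminate]. }
  assert (HG : is_RInt_gen (Derive f) (at_right 0) (Rbar_locally p_infty)
                 (s * Gamma s - Gamma (s + 1))).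
  { apply (is_RInt_gen_ext
      (fun t => minus (scal s (Gamma_integrand s t)) (Gamma_integrand (s + 1) t))).
    - apply at_right_0_infty_lt. simpl. intros u v Huv x Hx.
      rewrite Rmin_left in Hx by lra. symmetry. apply is_derive_unique.
      apply Hd. lra.
    - apply (is_RInt_gen_minus (fun t => scal s (Gamma_integrand s t))).
      + apply (is_RInt_gen_scal (Gamma_integrand s) s). now apply is_RInt_gen_Gamma.
      + apply is_RInt_gen_Gamma; lra. }
  generalize (is_RInt_gen_unique_R _ _ _ HD HG). lra.
Qed.

(** The quadratic in [x] is the integral of [t^(s-1) e^(-t) (sqrt t - x)^2]. Its discriminant gives
    the Cauchy-Schwarz inequality for [Gamma]. *)
Lemma Gamma_quadratic_ge_0 (s x : R) :
  0 < s -> 0 <= Gamma (s + 1) - 2 * x * Gamma (s + 1 / 2) + x ^ 2 * Gamma s.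
Proof.
  intro Hs.
  set (f := fun t => plus (minus (Gamma_integrand (s + 1) t)
              (scal (2 * x) (Gamma_integrand (s + 1 / 2) t)))
              (scal (x ^ 2) (Gamma_integrand s t))).
  assert (H : is_RInt_gen f (at_right 0) (Rbar_locally p_infty)
     (plus (minus (Gamma (s + 1)) (scal (2 * x) (Gamma (s + 1 / 2))))
        (scal (x ^ 2) (Gamma s)))).
  { apply (is_RInt_gen_plus (fun t => minus (Gamma_integrand (s + 1) t)
              (scal (2 * x) (Gamma_integrand (s + 1 / 2) t)))).
    - apply (is_RInt_gen_minus (Gamma_integrand (s + 1))).
      + apply is_RInt_gen_Gamma; lra.
      + apply (is_RInt_gen_scal (Gamma_integrand (s + 1 / 2))), is_RInt_gen_Gamma; lra.
    - now apply (is_RInt_gen_scal (Gamma_integrand s)), is_RInt_gen_Gamma. }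
  replace (_ + _) with (plus (minus (Gamma (s + 1)) (scal (2 * x) (Gamma (s + 1 / 2))))
        (scal (x ^ 2) (Gamma s))) by reflexivity.
  apply (is_RInt_gen_ge_0 f); [|exact H].
  intros t Ht. unfold f, Gamma_integrand, plus, minus, opp, scal, plus; simpl.
  unfold mult; simpl.
  set (P := Rpower t (s - 1)). set (Q := Rpower t (1 / 2)).
  replace (Rpower t (s + 1 / 2 - 1)) with (P * Q).
  2:{ unfold P, Q. rewrite <- Rpower_plus. f_equal. ring. }
  replace (Rpower t (s + 1 - 1)) with (P * Q * Q).
  2:{ unfold P, Q. rewrite <- !Rpower_plus. f_equal. field. }
  replace (_ + _) with (P * exp (- t) * (Q - x) ^ 2) by ring.
  apply Rmult_le_pos; [|apply pow2_ge_0].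
  left. apply Rmult_lt_0_compat; apply exp_pos.
Qed.

(** Midpoint log-convexity at [s] gives the upper bound and at [s + 1/2] the lower one, once
    [Gamma_S] removes the integer shifts. *)
Lemma Gamma_half_ratio (s : R) :
  0 < s ->
  s ^ 2 / (s + 1 / 2) <= (Gamma (s + 1 / 2) / Gamma s) ^ 2 <= s.
Proof.
  intro Hs.
  assert (CS : forall r, 0 < r -> Gamma (r + 1 / 2) ^ 2 <= Gamma r * Gamma (r + 1)).
  { intros r Hr. generalize (Gamma_pos r Hr); intro Hg.
    (* The quadratic is evaluated at its minimum. *)
    generalize (Gamma_quadratic_ge_0 r (Gamma (r + 1 / 2) / Gamma r) Hr); intro H.
    apply (Rmult_le_compat_l (Gamma r)) in H; [|lra].
    replace (Gamma r * (_ - _ + _))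
      with (Gamma r * Gamma (r + 1) - Gamma (r + 1 / 2) ^ 2) in H by (field; lra).
    lra. }
  generalize (Gamma_pos s Hs); intro Hg.
  assert (Hs2 : 0 < s + 1 / 2) by lra.
  generalize (Gamma_pos _ Hs2); intro Hg2.
  generalize (CS s Hs) (CS _ Hs2) (Gamma_S s Hs) (Gamma_S _ Hs2).
  replace (s + 1 / 2 + 1 / 2) with (s + 1) by field.
  intros H1 H2 E1 E2. rewrite E2, E1 in H2. rewrite E1 in H1.
  set (A := Gamma (s + 1 / 2)) in *. set (B := Gamma s) in *.
  assert (0 < B ^ 2) by now apply pow_lt.
  replace ((A / B) ^ 2) with (A ^ 2 / B ^ 2) by (field; lra).
  split; apply (Rmult_le_reg_r (B ^ 2)); try assumption.
  - replace (A ^ 2 / B ^ 2 * B ^ 2) with (A ^ 2) by (field; lra).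
    apply (Rmult_le_reg_r (s + 1 / 2)); [assumption|].
    replace (s ^ 2 / (s + 1 / 2) * B ^ 2 * (s + 1 / 2)) with ((s * B) ^ 2) by (field; lra).
    lra.
  - replace (A ^ 2 / B ^ 2 * B ^ 2) with (A ^ 2) by (field; lra). lra.
Qed.

(** * Integrals of powers of the cosine *)

Lemma eq_of_derive_0 (f : R -> R) (a b x y : R) :
  (forall t, a < t < b -> is_derive f t 0) ->
  a < x < b -> a < y < b -> f x = f y.
Proof.
  intros Hf Hx Hy.
  destruct (MVT_gen f x y (fun _ => 0)) as (c & _ & Hc).
  - intros t Ht. apply Hf. unfold Rmin, Rmax in Ht.
    destruct (Rle_dec x y); lra.
  - intros t Ht. apply continuity_pt_filterlim.
    apply (@ex_derive_continuous R_AbsRing R_NormedModule). exists 0. apply Hf.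
    unfold Rmin, Rmax in Ht. destruct (Rle_dec x y); lra.
  - lra.
Qed.

Lemma lt_of_derive_pos (f df : R -> R) (a b x y : R) :
  (forall t, a < t < b -> is_derive f t (df t)) ->
  (forall t, a < t < b -> 0 < df t) ->
  a < x < b -> a < y < b -> x < y -> f x < f y.
Proof.
  intros Hf Hdf Hx Hy Hxy.
  apply (incr_function f (Finite a) (Finite b) df); simpl; try lra.
  - intros; now apply Hf.
  - intros; now apply Hdf.
Qed.

(** The exponent is real because it will be [/ alpha - 2]; it can be negative, so statements are
    kept inside the open interval up to [PI / 2]. *)
Definition cosint (m x : R) : R := RInt (fun t => Rpower (cos t) m) 0 x.

Lemma cos_pos (x : R) : - (PI / 2) < x < PI / 2 -> 0 < cos x.
Proof. intro Hx. apply cos_gt_0; lra. Qed.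

Lemma is_derive_Rpower_cos (m x : R) :
  - (PI / 2) < x < PI / 2 ->
  is_derive (fun t => Rpower (cos t) m) x (- m * Rpower (cos x) (m - 1) * sin x).
Proof.
  intro Hx. evar_last.
  - apply (is_derive_comp (fun y => Rpower y m) cos).
    + now apply is_derive_Rpower, cos_pos.
    + apply is_derive_cos.
  - unfold scal; simpl; unfold mult; simpl. ring.
Qed.

Lemma Rpower_cos_continuous (m x : R) :
  - (PI / 2) < x < PI / 2 -> continuous (fun t => Rpower (cos t) m) x.
Proof.
  intro Hx. apply (@ex_derive_continuous R_AbsRing R_NormedModule).
  eexists. now apply is_derive_Rpower_cos.
Qed.

Lemma ex_RInt_Rpower_cos (m x y : R) :
  - (PI / 2) < x < PI / 2 -> - (PI / 2) < y < PI / 2 ->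
  ex_RInt (fun t => Rpower (cos t) m) x y.
Proof.
  intros Hx Hy. apply (@ex_RInt_continuous R_CompleteNormedModule).
  intros t Ht. apply Rpower_cos_continuous. unfold Rmin, Rmax in Ht.
  destruct (Rle_dec x y); lra.
Qed.

Lemma cosint_0 (m : R) : cosint m 0 = 0.
Proof. apply (RInt_point (V := R_CompleteNormedModule)). Qed.

Lemma is_derive_cosint (m x : R) :
  - (PI / 2) < x < PI / 2 -> is_derive (cosint m) x (Rpower (cos x) m).
Proof.
  intro Hx.
  apply (is_derive_RInt (fun t => Rpower (cos t) m) (cosint m) 0).
  - apply (locally_interval _ x (- (PI / 2)) (PI / 2)); simpl; try lra.
    intros y H1 H2. apply (@RInt_correct R_CompleteNormedModule).
    apply ex_RInt_Rpower_cos; lra.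
  - now apply Rpower_cos_continuous.
Qed.

Lemma cosint_increasing (m x y : R) :
  - (PI / 2) < x -> x < y -> y < PI / 2 -> cosint m x < cosint m y.
Proof.
  intros Hx Hxy Hy.
  apply (lt_of_derive_pos _ (fun t => Rpower (cos t) m) (- (PI / 2)) (PI / 2)); try lra.
  - intros; now apply is_derive_cosint.
  - intros; apply Rpower_pos.
Qed.

(** The usual reduction formula, valid for real [m]: the difference of the two sides vanishes at 0
    and has derivative 0 because [sin^2 + cos^2 = 1]. *)
Lemma cosint_parts (m x : R) :
  - (PI / 2) < x < PI / 2 ->
  (m + 2) * cosint (m + 2) x = (m + 1) * cosint m x + Rpower (cos x) (m + 1) * sin x.
Proof.
  intro Hx.
  set (f := fun x => (m + 2) * cosint (m + 2) x
                     - ((m + 1) * cosint m x + Rpower (cos x) (m + 1) * sin x)).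
  assert (E : f x = f 0).
  { apply (eq_of_derive_0 f (- (PI / 2)) (PI / 2)); try lra.
    intros t Ht. unfold f. evar_last.
    - apply @is_derive_minus.
      + apply is_derive_scal. now apply is_derive_cosint.
      + apply @is_derive_plus.
        * apply is_derive_scal. now apply is_derive_cosint.
        * apply (is_derive_mult (fun x => Rpower (cos x) (m + 1)) sin).
          -- now apply is_derive_Rpower_cos.
          -- apply is_derive_sin.
          -- intros; apply Rmult_comm.
    - unfold minus, plus, opp, mult; simpl.
      replace (m + 1 - 1) with m by ring.
      generalize (cos_pos t Ht); intro Hc.
      replace (Rpower (cos t) (m + 2)) with (Rpower (cos t) m * (cos t * cos t)).
      2:{ rewrite Rpower_plus. f_equal.
          change 2 with (INR 2). rewrite Rpower_pow by assumption. simpl; ring. }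
      rewrite (Rpower_plus m 1), Rpower_1 by assumption.
      generalize (sin2_cos2 t). unfold Rsqr. intro Hs.
      replace (_ + _) with ((m + 1) * Rpower (cos t) m *
        ((sin t * sin t + cos t * cos t) - 1)) by ring.
      rewrite Hs. ring. }
  unfold f in E. rewrite !cosint_0, sin_0 in E. lra.
Qed.

Lemma cosint_exponent_0 (x : R) : 0 < x < PI / 2 -> cosint 0 x = x.
Proof.
  intro Hx.
  apply (is_RInt_unique (fun t => Rpower (cos t) 0)).
  apply (is_RInt_ext (fun _ => 1)).
  - intros t Ht. rewrite Rmin_left, Rmax_right in Ht by lra.
    rewrite Rpower_O; [reflexivity|]. apply cos_pos; lra.
  - replace x with (scal (x - 0) 1) at 2 by (unfold scal; simpl; unfold mult; simpl; ring).
    apply (@is_RInt_const R_NormedModule).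
Qed.

Lemma cosint_exponent_1 (x : R) : 0 < x < PI / 2 -> cosint 1 x = sin x.
Proof.
  intro Hx.
  apply (is_RInt_unique (fun t => Rpower (cos t) 1)).
  apply (is_RInt_ext cos).
  - intros t Ht. rewrite Rmin_left, Rmax_right in Ht by lra.
    rewrite Rpower_1; [reflexivity|]. apply cos_pos; lra.
  - replace (sin x) with (minus (sin x) (sin 0))
      by (rewrite sin_0; unfold minus, plus, opp; simpl; ring).
    apply (is_RInt_derive sin).
    + intros; apply is_derive_sin.
    + intros t _. apply continuity_pt_filterlim. apply continuity_cos.
Qed.

Lemma cosint_le (m n x : R) :
  m <= n -> 0 < x < PI / 2 -> cosint n x <= cosint m x.
Proof.
  intros Hmn Hx. apply RInt_le; try apply ex_RInt_Rpower_cos; try lra.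
  intros t Ht.
  assert (Hc : 0 < cos t) by (apply cos_pos; lra).
  assert (Hl : ln (cos t) <= 0).
  { destruct (COS_bound t) as [_ [H|H]].
    - apply ln_increasing in H; [rewrite ln_1 in H; lra|assumption].
    - rewrite H, ln_1. apply Rle_refl. }
  unfold Rpower.
  destruct (Rle_lt_or_eq_dec (n * ln (cos t)) (m * ln (cos t))) as [H|H].
  - nra.
  - left. now apply exp_increasing.
  - rewrite H. apply Rle_refl.
Qed.

(** * Wallis integrals with real exponent *)

(** A one-sided limit, since for [-1 < m < 0] the integrand blows up at [PI / 2]. *)
Definition is_wallis (m l : R) : Prop :=
  filterlim (cosint m) (at_left (PI / 2)) (locally l).

Lemma at_left_PI2 (P : R -> Prop) :
  (forall x, 0 < x < PI / 2 -> P x) -> at_left (PI / 2) P.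
Proof.
  intro H. exists (mkposreal _ PI2_RGT_0). intros x Hx Hlt. apply H.
  change (Rabs (x - PI / 2) < PI / 2) in Hx. apply Rabs_def2 in Hx. lra.
Qed.

Lemma is_wallis_unique (m l1 l2 : R) : is_wallis m l1 -> is_wallis m l2 -> l1 = l2.
Proof.
  apply (@filterlim_locally_unique _ R_AbsRing R_NormedModule).
  apply Proper_StrongProper, at_left_proper_filter.
Qed.

Lemma is_wallis_le (m n lm ln : R) :
  m <= n -> is_wallis m lm -> is_wallis n ln -> ln <= lm.
Proof.
  intros Hmn Hm Hn.
  apply (filterlim_le (F := at_left (PI / 2)) (cosint n) (cosint m) (Finite ln) (Finite lm));
    try assumption.
  apply at_left_PI2. intros x Hx. now apply cosint_le.
Qed.

Lemma Rpower_cos_lim (m : R) :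
  0 < m -> filterlim (fun x => Rpower (cos x) m) (at_left (PI / 2)) (locally 0).
Proof.
  intro Hm. apply (filterlim_comp _ _ _ cos (fun y => Rpower y m) _ (at_right 0)).
  - intros P HP. unfold filtermap, at_right, within in *.
    assert (Hc : filterlim cos (locally (PI / 2)) (locally 0)).
    { rewrite <- cos_PI2. apply continuity_pt_filterlim. apply continuity_cos. }
    specialize (Hc _ HP). unfold filtermap in Hc.
    apply (filter_imp (fun x => (0 < cos x -> P (cos x)) /\ 0 < cos x)).
    { intros x [H1 H2]. now apply H1. }
    apply filter_and.
    + apply filter_le_within. exact Hc.
    + apply at_left_PI2. intros x Hx. apply cos_pos. lra.
  - now apply Rpower_lim_0.
Qed.

(** In the reduction formula the boundary term [cos^(m+1) sin] tends to 0 because [m + 1 > 0]. *)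
Lemma is_wallis_plus_2 (m l : R) :
  -1 < m -> is_wallis m l -> is_wallis (m + 2) ((m + 1) / (m + 2) * l).
Proof.
  intros Hm Hl. unfold is_wallis.
  apply (filterlim_ext_loc (fun x =>
    plus (scal ((m + 1) / (m + 2)) (cosint m x))
      (scal (/ (m + 2)) (Rpower (cos x) (m + 1) * sin x)))).
  - apply at_left_PI2. intros x Hx.
    assert (Hx' : - (PI / 2) < x < PI / 2) by lra.
    generalize (cosint_parts m x Hx'); intro E.
    apply (Rmult_eq_reg_l (m + 2)); [|lra]. rewrite E.
    unfold plus, scal; simpl; unfold mult; simpl. field. lra.
  - replace ((m + 1) / (m + 2) * l)
      with (plus (scal ((m + 1) / (m + 2)) l) (scal (/ (m + 2)) 0))
      by (unfold plus, scal; simpl; unfold mult; simpl; ring).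
    apply (filterlim_comp_2 (G := locally (scal ((m + 1) / (m + 2)) l))
             (H := locally (scal (/ (m + 2)) 0))).
    + apply (filterlim_comp _ _ _ (cosint m) (scal ((m + 1) / (m + 2))) _ (locally l)).
      * exact Hl.
      * apply (@filterlim_scal_r R_AbsRing R_NormedModule).
    + apply (filterlim_comp _ _ _ (fun x => Rpower (cos x) (m + 1) * sin x)
               (scal (/ (m + 2))) _ (locally 0)).
      * apply (filterlim_le_le (fun _ => 0) _ (fun x => Rpower (cos x) (m + 1)) (Finite 0)).
        -- apply at_left_PI2. intros x Hx.
           generalize (Rpower_pos (cos x) (m + 1)) (SIN_bound x). intros H1 H2.
           assert (0 < sin x) by (apply sin_gt_0; lra). nra.
        -- apply filterlim_const.
        -- apply Rpower_cos_lim. lra.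
      * apply (@filterlim_scal_r R_AbsRing R_NormedModule).
    + apply (@filterlim_plus R_AbsRing R_NormedModule).
Qed.

(** The recurrence makes [(n + 1) I_n I_(n+1)] independent of [n]; at [n = 0] it is [PI / 2]. *)
Lemma is_wallis_INR (n : nat) :
  exists l l', is_wallis (INR n) l /\ is_wallis (INR (S n)) l'
    /\ (INR n + 1) * l * l' = PI / 2 /\ 0 < l /\ 0 < l'.
Proof.
  induction n as [|n (l & l' & Hl & Hl' & E & H0 & H1)].
  - exists (PI / 2), 1. repeat split.
    + apply (filterlim_ext_loc (fun x => x)).
      { apply at_left_PI2. intros x Hx. symmetry. now apply cosint_exponent_0. }
      intros P HP. apply filter_le_within. exact HP.
    + apply (filterlim_ext_loc sin).
      { apply at_left_PI2. intros x Hx. symmetry. now apply cosint_exponent_1. }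
      assert (Hc : filterlim sin (locally (PI / 2)) (locally 1)).
      { rewrite <- sin_PI2. apply continuity_pt_filterlim. apply continuity_sin. }
      intros P HP. apply filter_le_within. exact (Hc P HP).
    + simpl. field.
    + apply PI2_RGT_0.
    + lra.
  - generalize (pos_INR n); intro Hn.
    assert (Hq : 0 < (INR n + 1) / (INR n + 2)) by (apply Rdiv_lt_0_compat; lra).
    exists l', ((INR n + 1) / (INR n + 2) * l). repeat split; try assumption.
    + replace (INR (S (S n))) with (INR n + 2) by (rewrite !S_INR; ring).
      apply is_wallis_plus_2; [lra|assumption].
    + rewrite S_INR, <- E. field. lra.
    + now apply Rmult_lt_0_compat.
Qed.

(** The limits decrease in the exponent. With [n + 1 <= m < n + 2], [l^2] lies between
    [I_(n+2) I_(n+3)] and [I_n I_(n+1)], two products known from the integer case. *)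
Lemma is_wallis_bounds (m l : R) :
  1 < m -> is_wallis m l -> PI / (2 * (m + 2)) <= l ^ 2 <= PI / (2 * (m - 1)).
Proof.
  intros Hm Hl.
  destruct (nfloor_ex m) as (n & Hn1 & Hn2); [lra|].
  destruct n as [|n]; [simpl in Hn2; lra|].
  destruct (is_wallis_INR n) as (l0 & l1 & H0 & H1 & E0 & P0 & P1).
  destruct (is_wallis_INR (S n)) as (l1' & l2 & H1' & H2 & E1 & _ & P2).
  destruct (is_wallis_INR (S (S n))) as (l2' & l3 & H2' & H3 & E2 & _ & P3).
  rewrite <- (is_wallis_unique _ _ _ H1 H1') in E1.
  rewrite <- (is_wallis_unique _ _ _ H2 H2') in E2.
  rewrite !S_INR in *. generalize (pos_INR n); intro Hn.
  assert (L1 : l <= l1) by (apply (is_wallis_le (INR n + 1) m); try assumption; lra).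
  assert (L2 : l2 <= l) by (apply (is_wallis_le m (INR n + 1 + 1)); try assumption; lra).
  assert (L0 : l1 <= l0) by (apply (is_wallis_le (INR n) (INR n + 1)); try assumption; lra).
  assert (L3 : l3 <= l2)
    by (apply (is_wallis_le (INR n + 1 + 1) (INR n + 1 + 1 + 1)); try assumption; lra).
  split.
  - apply (Rmult_le_reg_r (2 * (m + 2))); [lra|].
    unfold Rdiv. rewrite Rmult_assoc, Rinv_l, Rmult_1_r by lra.
    replace PI with (2 * ((INR n + 1 + 1 + 1) * (l2 * l3))) by lra.
    assert (l2 * l3 <= l ^ 2) by nra.
    assert (0 < l2 * l3) by now apply Rmult_lt_0_compat.
    assert ((INR n + 1 + 1 + 1) * (l2 * l3) <= (m + 2) * l ^ 2).
    { apply Rmult_le_compat; lra. }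
    lra.
  - apply (Rmult_le_reg_r (2 * (m - 1))); [lra|].
    unfold Rdiv. rewrite (Rmult_assoc PI), Rinv_l, Rmult_1_r by lra.
    replace PI with (2 * ((INR n + 1) * (l0 * l1))) by lra.
    assert (l ^ 2 <= l0 * l1) by nra.
    assert ((m - 1) * l ^ 2 <= (INR n + 1) * (l0 * l1)).
    { apply Rmult_le_compat; try lra. apply pow2_ge_0. }
    lra.
Qed.

(* The ratio [r] of the two sides, up to the factor [sqrt PI / 2], is invariant
   under [m -> m + 2]; Wallis' inequalities and the log-convexity of [Gamma]
   give [r ^ 2 -> PI / 4] along [m + 2 k]. *)
Lemma is_wallis_Gamma (m l : R) :
  -1 < m -> is_wallis m l ->
  l = sqrt PI / 2 * Gamma ((m + 1) / 2) / Gamma (m / 2 + 1).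
Proof.
  intros Hm Hl.
  set (q := fun m => Gamma ((m + 1) / 2 + 1 / 2) / Gamma ((m + 1) / 2)).
  assert (Hk : forall k, is_wallis (m + 2 * INR k) (l * q m / q (m + 2 * INR k))
            /\ 0 < q (m + 2 * INR k)).
  { assert (Hq : forall x, -1 < x -> 0 < q x).
    { intros x Hx. apply Rdiv_lt_0_compat; apply Gamma_pos; lra. }
    induction k as [|k [IH _]].
    - simpl. rewrite Rmult_0_r, Rplus_0_r. generalize (Hq m Hm); intro.
      split; [|assumption]. replace (l * q m / q m) with l by (field; lra).
      assumption.
    - generalize (pos_INR k); intro Hk0.
      set (M := m + 2 * INR k) in *.
      replace (m + 2 * INR (S k)) with (M + 2) by (rewrite S_INR; unfold M; ring).
      assert (HM : -1 < M) by (unfold M; lra).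
      split; [|apply Hq; lra].
      replace (l * q m / q (M + 2)) with ((M + 1) / (M + 2) * (l * q m / q M)).
      + now apply is_wallis_plus_2.
      + assert (E : q (M + 2) = (M + 2) / (M + 1) * q M).
        { unfold q.
          replace ((M + 2 + 1) / 2 + 1 / 2) with ((M + 1) / 2 + 1 / 2 + 1) by field.
          replace ((M + 2 + 1) / 2) with ((M + 1) / 2 + 1) by field.
          rewrite !Gamma_S by lra. field.
          assert (Hg : 0 < Gamma ((M + 1) / 2)) by (apply Gamma_pos; lra). lra. }
        rewrite E. field. generalize (Hq M HM). lra. }
  assert (Hl0 : 0 <= l).
  { apply (filterlim_le (F := at_left (PI / 2)) (fun _ => 0) (cosint m) (Finite 0) (Finite l)).
    - apply at_left_PI2. intros x Hx. rewrite <- (cosint_0 m). left.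
      apply cosint_increasing; lra.
    - apply filterlim_const.
    - exact Hl. }
  set (r := l * q m) in *.
  (* Exponent [m + 2 (k + 1)], written [N + 1], is used because it exceeds 1 even for [k = 0] and
     [m] near -1, as the Wallis bounds require. Both bounds on [r^2] differ from [PI / 4] by
     [O(1/N)]. *)
  assert (Hb : forall k, Rabs (r ^ 2 - PI / 4) * (m + 1 + 2 * INR k) <= PI / 2).
  { intro k. destruct (Hk (S k)) as [Hw Hq].
    rewrite S_INR in Hw, Hq.
    replace (m + 2 * (INR k + 1)) with (m + 1 + 2 * INR k + 1) in Hw, Hq by ring.
    generalize (pos_INR k); intro Hk0.
    set (N := m + 1 + 2 * INR k) in *.
    assert (HN : 0 < N) by (unfold N; lra).
    assert (HN1 : 1 < N + 1) by lra.
    destruct (is_wallis_bounds _ _ HN1 Hw) as [W1 W2].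
    assert (Hs : 0 < (N + 1 + 1) / 2) by lra.
    destruct (Gamma_half_ratio _ Hs) as [G1 G2].
    fold (q (N + 1)) in G1, G2.
    set (p := q (N + 1)) in *. clearbody p.
    assert (Hp : 0 < p ^ 2) by now apply pow_lt.
    replace ((r / p) ^ 2) with (r ^ 2 / p ^ 2) in W1, W2 by (field; lra).
    apply (Rmult_le_compat_r (p ^ 2)) in W1; [|lra].
    apply (Rmult_le_compat_r (p ^ 2)) in W2; [|lra].
    replace (r ^ 2 / p ^ 2 * p ^ 2) with (r ^ 2) in W1, W2 by (field; lra).
    generalize PI_RGT_0; intro Hpi.
    assert (U : r ^ 2 <= PI / (2 * (N + 1 - 1)) * ((N + 1 + 1) / 2)).
    { eapply Rle_trans; [exact W2|]. apply Rmult_le_compat_l; [|assumption].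
      left. apply Rdiv_lt_0_compat; lra. }
    assert (L : PI / (2 * (N + 1 + 2)) * (((N + 1 + 1) / 2) ^ 2 / ((N + 1 + 1) / 2 + 1 / 2))
                <= r ^ 2).
    { eapply Rle_trans; [|exact W1]. apply Rmult_le_compat_l; [|assumption].
      left. apply Rdiv_lt_0_compat; lra. }
    assert (U' : (r ^ 2 - PI / 4) * N <= PI / 2).
    { apply (Rmult_le_compat_r N) in U; [|lra].
      replace (PI / (2 * (N + 1 - 1)) * ((N + 1 + 1) / 2) * N)
        with (PI / 4 * (N + 2)) in U by (field; lra). lra. }
    assert (L' : - (PI / 2) <= (r ^ 2 - PI / 4) * N).
    { apply (Rmult_le_compat_r N) in L; [|lra].
      replace (PI / (2 * (N + 1 + 2)) * (((N + 1 + 1) / 2) ^ 2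
                 / ((N + 1 + 1) / 2 + 1 / 2)) * N)
        with (PI / 4 * N - PI / 2 * ((N + 5 / 2) * N / (N + 3) ^ 2)) in L by (field; lra).
      assert ((N + 5 / 2) * N / (N + 3) ^ 2 <= 1).
      { apply (Rmult_le_reg_r ((N + 3) ^ 2)); [apply pow_lt; lra|].
        replace ((N + 5 / 2) * N / (N + 3) ^ 2 * (N + 3) ^ 2)
          with ((N + 5 / 2) * N) by (field; lra). nra. }
      nra. }
    unfold Rabs; destruct (Rcase_abs (r ^ 2 - PI / 4)); lra. }
  assert (Hr : r ^ 2 = PI / 4).
  (* A nonzero distance [d] would contradict [Hb] as soon as [k] exceeds [PI / (2 d)]. *)
  { apply Rminus_diag_uniq. apply Classical_Prop.NNPP. intro Hne.
    assert (Ha : 0 < Rabs (r ^ 2 - PI / 4)) by now apply Rabs_pos_lt.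
    set (d := Rabs (r ^ 2 - PI / 4)) in *.
    destruct (nfloor_ex (PI / 2 / d)) as (n & _ & Hn).
    { left. apply Rdiv_lt_0_compat; [apply PI2_RGT_0|assumption]. }
    specialize (Hb (S n)). rewrite S_INR in Hb.
    apply (Rmult_lt_compat_r d) in Hn; [|assumption].
    replace (PI / 2 / d * d) with (PI / 2) in Hn by (field; lra).
    generalize (pos_INR n). nra. }
  destruct (Hk 0%nat) as [_ Hq]. simpl in Hq. rewrite Rmult_0_r, Rplus_0_r in Hq.
  assert (Hr' : r = sqrt PI / 2).
  { apply Rsqr_inj.
    - unfold r. apply Rmult_le_pos; lra.
    - generalize (sqrt_pos PI). lra.
    - unfold Rsqr. replace (sqrt PI / 2 * (sqrt PI / 2)) with (sqrt PI * sqrt PI / 4) by field.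
      rewrite sqrt_sqrt by (left; apply PI_RGT_0). lra. }
  assert (Hg1 : 0 < Gamma ((m + 1) / 2)) by (apply Gamma_pos; lra).
  assert (Hg2 : 0 < Gamma (m / 2 + 1)) by (apply Gamma_pos; lra).
  rewrite <- Hr'. unfold r, q.
  replace ((m + 1) / 2 + 1 / 2) with (m / 2 + 1) by field.
  field. lra.
Qed.

(** * The hypergeometric function *)

(** Taylor coefficients of [(1 - x)^(-1/2)]. *)
Definition invsqrt_coeff (n : nat) : R := pochhammer (1 / 2) n / INR (fact n).

Definition hyp_coeff (b : R) (n : nat) : R :=
  pochhammer (1 / 2) n * pochhammer b n / (pochhammer (b + 1) n * INR (fact n)).

Lemma pochhammer_pos (x : R) (n : nat) : 0 < x -> 0 < pochhammer x n.
Proof.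
  intro Hx. induction n as [|n IH]; simpl; [lra|].
  apply Rmult_lt_0_compat; [assumption|]. generalize (pos_INR n). lra.
Qed.

Lemma pochhammer_shift (x : R) (n : nat) :
  pochhammer x n * (x + INR n) = x * pochhammer (x + 1) n.
Proof.
  induction n as [|n IH].
  - simpl. ring.
  - rewrite S_INR. simpl. rewrite IH. ring.
Qed.

Lemma invsqrt_coeff_S (n : nat) :
  INR (S n) * invsqrt_coeff (S n) = (INR n + 1 / 2) * invsqrt_coeff n.
Proof.
  unfold invsqrt_coeff. rewrite fact_simpl, mult_INR. simpl pochhammer.
  field. split; [apply INR_fact_neq_0|]. apply not_0_INR. lia.
Qed.

Lemma invsqrt_coeff_bounds (n : nat) : 0 <= invsqrt_coeff n <= 1.
Proof.
  induction n as [|n IH].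
  - unfold invsqrt_coeff. simpl. lra.
  - generalize (invsqrt_coeff_S n) (pos_INR n). rewrite S_INR. intros E Hn. nra.
Qed.

(** With third parameter [b + 1] the two Pochhammer symbols in [b] telescope to [b / (b + n)]. *)
Lemma hyp_coeff_eq (b : R) (n : nat) :
  0 < b -> (b + INR n) * hyp_coeff b n = b * invsqrt_coeff n.
Proof.
  intro Hb. unfold hyp_coeff, invsqrt_coeff.
  assert (Hb1 : 0 < b + 1) by lra.
  generalize (pochhammer_shift b n) (pochhammer_pos (b + 1) n Hb1) (INR_fact_neq_0 n).
  intros E H1 H2.
  replace ((b + INR n) * (pochhammer (1 / 2) n * pochhammer b n
             / (pochhammer (b + 1) n * INR (fact n))))
    with (pochhammer (1 / 2) n * (pochhammer b n * (b + INR n))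
             / (pochhammer (b + 1) n * INR (fact n))) by (field; lra).
  rewrite E. field. lra.
Qed.

Lemma hyp_coeff_bounds (b : R) (n : nat) : 0 < b -> 0 <= hyp_coeff b n <= 1.
Proof.
  intro Hb.
  generalize (hyp_coeff_eq b n Hb) (invsqrt_coeff_bounds n) (pos_INR n).
  intros E [H1 H2] Hn. split.
  - apply Rnot_lt_le. intro H. nra.
  - apply (Rmult_le_reg_l (b + INR n)); [lra|]. nra.
Qed.

Lemma lt_CV_radius (u : nat -> R) (x : R) :
  (forall n, 0 <= u n <= 1) -> Rabs x < 1 -> Rbar_lt (Rabs x) (CV_radius u).
Proof.
  intros Hu Hx. apply (Rbar_lt_le_trans _ (Finite 1)); [exact Hx|].
  apply (proj1 (CV_radius_bounded u) 1). exists 1. intro n.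
  rewrite pow1, Rmult_1_r, Rabs_pos_eq; apply Hu.
Qed.

Lemma PSeries_PS_incr_derive (u : nat -> R) (n : nat) :
  PS_incr_1 (PS_derive u) n = INR n * u n.
Proof.
  destruct n as [|n]; simpl.
  - unfold zero; simpl. ring.
  - reflexivity.
Qed.

(** The coefficient recurrence says [(1 - x) f' = f / 2], so [f sqrt(1 - x)] is constant. *)
Lemma invsqrt_series (x : R) : -1 < x < 1 -> PSeries invsqrt_coeff x * sqrt (1 - x) = 1.
Proof.
  intro Hx.
  set (f := fun x => PSeries invsqrt_coeff x * sqrt (1 - x)).
  assert (E : f x = f 0).
  { apply (eq_of_derive_0 f (- 1) 1); try lra.
    intros t Ht. unfold f.
    assert (Hr : Rbar_lt (Rabs t) (CV_radius invsqrt_coeff)).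
    { apply lt_CV_radius; [apply invsqrt_coeff_bounds|]. now apply Rabs_def1. }
    assert (ODE : PSeries (PS_derive invsqrt_coeff) t
             = t * PSeries (PS_derive invsqrt_coeff) t + 1 / 2 * PSeries invsqrt_coeff t).
    { rewrite <- PSeries_incr_1, <- PSeries_scal, <- PSeries_plus.
      - apply PSeries_ext. intro n.
        unfold PS_plus, PS_scal, plus, scal; simpl. unfold mult; simpl.
        rewrite PSeries_PS_incr_derive. unfold PS_derive. rewrite invsqrt_coeff_S. ring.
      - apply ex_pseries_incr_1, CV_radius_inside.
        now rewrite CV_radius_derive.
      - apply (ex_pseries_scal (V := R_NormedModule)); [apply Rmult_comm|].
        now apply CV_radius_inside. }
    assert (Hs : 0 < sqrt (1 - t)) by (apply sqrt_lt_R0; lra).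
    evar_last.
    - apply (is_derive_mult (PSeries invsqrt_coeff) (fun x => sqrt (1 - x))).
      + now apply is_derive_PSeries.
      + instantiate (1 := - / (2 * sqrt (1 - t))). auto_derive; [lra|].
        replace (1 + - t) with (1 - t) by ring. field. lra.
      + intros; apply Rmult_comm.
    - unfold plus, mult; simpl.
      apply (Rmult_eq_reg_r (sqrt (1 - t))); [|lra]. rewrite Rmult_0_l.
      replace ((_ + _) * sqrt (1 - t))
        with (PSeries (PS_derive invsqrt_coeff) t * (sqrt (1 - t) * sqrt (1 - t))
              - 1 / 2 * PSeries invsqrt_coeff t) by (field; lra).
      rewrite sqrt_sqrt by lra. lra. }
  fold (f x). rewrite E. unfold f. rewrite PSeries_0, Rminus_0_r, sqrt_1.
  unfold invsqrt_coeff. simpl. field.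
Qed.

(** The operator [b + x d/dx] multiplies the n-th coefficient by [b + n], which cancels the
    denominator and leaves [b] times the series of [(1 - x)^(-1/2)]. *)
Lemma hyp2F1_half_ODE (b x : R) :
  0 < b -> -1 < x < 1 ->
  exists d, is_derive (hyp2F1 (1 / 2) b (b + 1)) x d
    /\ b * hyp2F1 (1 / 2) b (b + 1) x + x * d = b / sqrt (1 - x).
Proof.
  intros Hb Hx.
  assert (Hx' : Rabs x < 1) by now apply Rabs_def1.
  assert (Hr : Rbar_lt (Rabs x) (CV_radius (hyp_coeff b))).
  { apply lt_CV_radius; [|assumption]. intro; now apply hyp_coeff_bounds. }
  exists (PSeries (PS_derive (hyp_coeff b)) x). split.
  { now apply is_derive_PSeries. }
  assert (Hs : 0 < sqrt (1 - x)) by (apply sqrt_lt_R0; lra).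
  replace (b / sqrt (1 - x)) with (b * PSeries invsqrt_coeff x).
  2:{ generalize (invsqrt_series x Hx). intro E.
      apply (Rmult_eq_reg_r (sqrt (1 - x))); [|lra].
      rewrite Rmult_assoc, E. field. lra. }
  change (hyp2F1 (1 / 2) b (b + 1) x) with (PSeries (hyp_coeff b) x).
  rewrite <- PSeries_incr_1, <- !PSeries_scal, <- PSeries_plus.
  - apply PSeries_ext. intro n.
    unfold PS_plus, PS_scal, plus, scal; simpl. unfold mult; simpl.
    rewrite PSeries_PS_incr_derive, <- hyp_coeff_eq by assumption. ring.
  - apply (ex_pseries_scal (V := R_NormedModule)); [apply Rmult_comm|].
    now apply CV_radius_inside.
  - apply ex_pseries_incr_1, CV_radius_inside.
    now rewrite CV_radius_derive.
Qed.

(** At argument [cos^2] the factor [(1 - z^2)^(-1/2)] is [1 / sin], which cancels the [sin] from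
    differentiating the cosine. The two derivatives are then opposite. *)
Lemma hyp2F1_cosint_const (b : R) :
  0 < b ->
  exists K, forall x, 0 < x < PI / 2 ->
    Rpower (cos x) (2 * b) * hyp2F1 (1 / 2) b (b + 1) (cos x ^ 2)
    + 2 * b * cosint (2 * b - 1) x = K.
Proof.
  intro Hb. generalize PI_RGT_0; intro Hpi.
  set (f := fun x => Rpower (cos x) (2 * b) * hyp2F1 (1 / 2) b (b + 1) (cos x ^ 2)
    + 2 * b * cosint (2 * b - 1) x).
  exists (f (PI / 4)). intros x Hx.
  apply (eq_of_derive_0 f 0 (PI / 2)); try lra.
  intros t Ht. unfold f.
  assert (Hc : 0 < cos t) by (apply cos_pos; lra).
  assert (Hs : 0 < sin t) by (apply sin_gt_0; lra).
  generalize (sin2_cos2 t). unfold Rsqr. intro Hsc.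
  destruct (hyp2F1_half_ODE b (cos t ^ 2) Hb) as (d & Hd & E); [nra|].
  replace (1 - cos t ^ 2) with (sin t * sin t) in E by (rewrite <- Hsc; ring).
  rewrite sqrt_square in E by lra.
  evar_last.
  - apply @is_derive_plus.
    + apply (is_derive_mult (fun x => Rpower (cos x) (2 * b))
               (fun x => hyp2F1 (1 / 2) b (b + 1) (cos x ^ 2))).
      * apply is_derive_Rpower_cos. lra.
      * apply (is_derive_comp (hyp2F1 (1 / 2) b (b + 1)) (fun x => cos x ^ 2)).
        -- exact Hd.
        -- instantiate (1 := - 2 * cos t * sin t). auto_derive; [trivial|ring].
      * intros; apply Rmult_comm.
    + apply is_derive_scal. apply is_derive_cosint. lra.
  - unfold plus, scal; simpl; unfold mult; simpl.
    rewrite <- (Rpower_minus_1 (cos t) (2 * b)) by assumption.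
    set (P := Rpower (cos t) (2 * b - 1)). simpl pow in E.
    set (g := hyp2F1 (1 / 2) b (b + 1) (cos t * (cos t * 1))) in *.
    replace (_ + _) with (2 * P * (b - sin t * (b * g + cos t * (cos t * 1) * d))) by ring.
    rewrite E. field. lra.
Qed.

(** The constant [K] is found at [PI / 2]: there the hypergeometric term tends to 0, since [2 b > 0]
    and the series is continuous at 0. Thus [K / (2 b)] is a Wallis limit, whose Gamma value forces
    [K = C]. *)
Lemma hyp2F1_cosint (b : R) :
  0 < b ->
  let C := sqrt PI * Gamma (b + 1) / Gamma (b + 1 / 2) in
  is_wallis (2 * b - 1) (C / (2 * b))
  /\ forall x, 0 < x < PI / 2 ->
     Rpower (cos x) (2 * b) * hyp2F1 (1 / 2) b (b + 1) (cos x ^ 2)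
     = C - 2 * b * cosint (2 * b - 1) x.
Proof.
  intros Hb C.
  destruct (hyp2F1_cosint_const b Hb) as (K & HK).
  set (h := fun y => Rpower (cos y) (2 * b) * hyp2F1 (1 / 2) b (b + 1) (cos y ^ 2)).
  assert (Hh : filterlim h (at_left (PI / 2)) (locally 0)).
  { set (l := hyp2F1 (1 / 2) b (b + 1) (cos (PI / 2) ^ 2)).
    rewrite <- (Rmult_0_l l).
    apply (filterlim_comp_2 (G := locally 0) (H := locally l)).
    - apply Rpower_cos_lim. lra.
    - assert (Hc : continuous (fun y => hyp2F1 (1 / 2) b (b + 1) (cos y ^ 2)) (PI / 2)).
      { apply (@ex_derive_continuous R_AbsRing R_NormedModule).
        apply (ex_derive_comp (hyp2F1 (1 / 2) b (b + 1)) (fun y => cos y ^ 2)).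
        - destruct (hyp2F1_half_ODE b (cos (PI / 2) ^ 2) Hb) as (d & Hd & _).
          + rewrite cos_PI2. simpl. lra.
          + now exists d.
        - auto_derive. trivial. }
      intros P HP. apply filter_le_within. exact (Hc P HP).
    - apply (@filterlim_mult R_AbsRing). }
  assert (W : is_wallis (2 * b - 1) (K / (2 * b))).
  { rewrite <- (Rminus_0_r K). apply (filterlim_ext_loc (fun y => (K - h y) / (2 * b))).
    { apply at_left_PI2. intros y Hy. rewrite <- (HK y Hy). unfold h. field. lra. }
    apply (filterlim_comp _ _ _ h (fun u => (K - u) / (2 * b)) _ (locally 0) _ Hh).
    apply (@ex_derive_continuous R_AbsRing R_NormedModule (fun u => (K - u) / (2 * b))).
    auto_derive. trivial. }
  assert (E : C = K).
  { generalize W; intro W'. apply is_wallis_Gamma in W'; [|lra].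
    replace ((2 * b - 1 + 1) / 2) with b in W' by field.
    replace ((2 * b - 1) / 2 + 1) with (b + 1 / 2) in W' by field.
    unfold C. rewrite Gamma_S by assumption.
    assert (0 < Gamma (b + 1 / 2)) by (apply Gamma_pos; lra).
    apply (Rmult_eq_reg_r (/ (2 * b))); [|apply Rinv_neq_0_compat; lra].
    fold (K / (2 * b)). rewrite W'. field. lra. }
  rewrite E. split; [exact W|]. intros x Hx. rewrite <- (HK x Hx). ring.
Qed.

(** * Definite description and inverse functions *)

Lemma the_eq (T : Type) (d : T) (P : T -> Prop) (x : T) :
  P x -> (forall y, P y -> y = x) -> the d P = x.
Proof.
  intros Hx Huniq. unfold the. apply Huniq.
  apply (epsilon_spec (inhabits d) (unique P)).
  exists x. split; [assumption|]. intros y Hy. symmetry. now apply Huniq.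
Qed.

(** Positivity of the derivative on the closed interval makes [f] strictly increasing up to both
    ends; monotonicity then makes the inverse continuous, hence differentiable. *)
Lemma inverse_function (f df : R -> R) (a b : R) :
  a < b ->
  (forall x, a <= x <= b -> is_derive f x (df x)) ->
  (forall x, a <= x <= b -> 0 < df x) ->
  exists g, forall y, f a < y < f b ->
    a < g y < b /\ f (g y) = y /\ is_derive g y (/ df (g y)).
Proof.
  intros Hab Hd Hpos.
  assert (Hinc : forall x y, a <= x -> x < y -> y <= b -> f x < f y).
  { intros x y Hx Hxy Hy.
    destruct (MVT_cor2 f df x y Hxy) as (c & Hc1 & Hc2).
    - intros c Hc. apply is_derive_Reals, Hd. lra.
    - assert (0 < df c) by (apply Hpos; lra). nra. }
  assert (Hinc' : forall x y, a <= x <= b -> a <= y <= b -> f x < f y -> x < y).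
  { intros x y Hx Hy H. apply Rnot_le_lt. intros [h|h].
    - assert (f y < f x) by (apply Hinc; lra). lra.
    - rewrite h in H. lra. }
  set (g := fun y => epsilon (inhabits 0) (fun x => a < x < b /\ f x = y)).
  assert (Hg : forall y, f a < y < f b -> a < g y < b /\ f (g y) = y).
  { intros y Hy. unfold g. apply epsilon_spec.
    assert (Hcont : forall x, a <= x <= b -> continuity_pt f x).
    { intros x Hx. apply continuity_pt_filterlim.
      apply (@ex_derive_continuous R_AbsRing R_NormedModule).
      exists (df x). now apply Hd. }
    destruct (IVT_Rbar_incr f a b (f a) (f b) y) as (x & H1 & H2 & H3); simpl; try assumption.
    - apply is_lim_continuity, Hcont. lra.
    - apply is_lim_continuity, Hcont. lra.
    - intros x H1 H2. apply Hcont. lra.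
    - now exists x. }
  exists g. intros y Hy. destruct (Hg y Hy) as [Hgy Hfg].
  split; [assumption|split; [assumption|]].
  set (x := g y) in *.
  (* Continuity of [g] at [y]: points [x1 < x < x2] close to [x] and inside the interval are mapped
     to values around [y], which trap [g z]. *)
  assert (Hc : forall eps, 0 < eps -> exists delta, 0 < delta /\ forall z, Rabs (z - y) < delta ->
     f a < z < f b /\ Rabs (g z - x) < eps).
  { intros eps Heps.
    set (x1 := Rmax (x - eps / 2) ((a + x) / 2)). set (x2 := Rmin (x + eps / 2) ((b + x) / 2)).
    assert (H1 : a < x1 < x /\ x - x1 < eps) by (unfold x1, Rmax; destruct (Rle_dec (x - eps / 2) ((a + x) / 2)); lra).
    assert (H2 : x < x2 < b /\ x2 - x < eps) by (unfold x2, Rmin; destruct (Rle_dec (x + eps / 2) ((b + x) / 2)); lra).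
    assert (F1 : f x1 < f x) by (apply Hinc; lra).
    assert (F2 : f x < f x2) by (apply Hinc; lra).
    assert (F3 : f a < f x1) by (apply Hinc; lra).
    assert (F4 : f x2 < f b) by (apply Hinc; lra).
    exists (Rmin (f x - f x1) (f x2 - f x)). split; [apply Rmin_pos; lra|].
    intros z Hz. rewrite <- Hfg in Hz. apply Rabs_def2 in Hz.
    generalize (Rmin_l (f x - f x1) (f x2 - f x)) (Rmin_r (f x - f x1) (f x2 - f x)).
    intros M1 M2. assert (Hz' : f a < z < f b) by lra.
    split; [assumption|]. destruct (Hg z Hz') as [Hgz Hfz].
    assert (x1 < g z) by (apply Hinc'; lra).
    assert (g z < x2) by (apply Hinc'; lra).
    apply Rabs_def1; lra. }
  apply is_derive_Reals. intros eps Heps.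
  assert (Hdx : 0 < df x) by (apply Hpos; lra).
  (* The quotients of [g] are reciprocals of quotients of [f], so continuity of the reciprocal
     transfers the limit. *)
  assert (Hinv : continuous Rinv (df x)).
  { apply (@ex_derive_continuous R_AbsRing R_NormedModule). auto_derive. lra. }
  destruct (proj1 (filterlim_locally _ _) Hinv (mkposreal _ Heps)) as [eta Heta].
  assert (Hdf : derivable_pt_lim f x (df x)) by (apply is_derive_Reals, Hd; lra).
  destruct (Hdf eta (cond_pos eta)) as [d1 Hd1].
  destruct (Hc d1 (cond_pos d1)) as (d2 & Hd2 & Hz).
  exists (mkposreal _ Hd2). intros h Hh0 Hh. simpl in Hh.
  destruct (Hz (y + h)) as [Hyh Hgh].
  { replace (y + h - y) with h by ring. assumption. }
  destruct (Hg _ Hyh) as [_ Hfh].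
  set (k := g (y + h) - x) in *.
  assert (Ek : g (y + h) = x + k) by (unfold k; ring).
  rewrite Ek in Hfh.
  assert (Hk : k <> 0).
  { intro E. rewrite E, Rplus_0_r, Hfg in Hfh. lra. }
  specialize (Hd1 k Hk Hgh). rewrite Hfh, Hfg in Hd1.
  replace (y + h - y) with h in Hd1 by ring.
  specialize (Heta (h / k) Hd1).
  rewrite Ek. fold x. replace (x + k - x) with k by ring.
  replace (k / h) with (/ (h / k)) by (field; lra).
  exact Heta.
Qed.

(** Below the limit [l] some [b < PI / 2] already has [cosint m b > v], which reduces the claim to a
    compact interval. *)
Lemma cosint_surjective (m l v : R) :
  is_wallis m l -> 0 < v < l -> exists x, 0 < x < PI / 2 /\ cosint m x = v.
Proof.
  intros Hl Hv. generalize PI2_RGT_0; intro Hpi.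
  assert (exists b, 0 < b < PI / 2 /\ v < cosint m b) as (b & Hb & Hvb).
  { assert (Hpos : 0 < l - v) by lra.
    assert (Hev : at_left (PI / 2) (fun x => v < cosint m x)).
    { apply (filter_imp (fun x => ball l (mkposreal _ Hpos) (cosint m x))).
      - intros x Hx. change (Rabs (cosint m x - l) < l - v) in Hx.
        apply Rabs_def2 in Hx. lra.
      - exact (proj1 (filterlim_locally _ _) Hl (mkposreal _ Hpos)). }
    apply (filter_ex (F := at_left (PI / 2))). apply filter_and; [|exact Hev].
    now apply at_left_PI2. }
  destruct (inverse_function (cosint m) (fun x => Rpower (cos x) m) 0 b) as (g & Hg).
  - lra.
  - intros x Hx. apply is_derive_cosint. lra.
  - intros. apply Rpower_pos.
  - destruct (Hg v) as (H1 & H2 & _); [rewrite cosint_0; lra|].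
    exists (g v). split; [lra|assumption].
Qed.

(** * Spacelike geodesics orthogonal to the central observer *)

Definition power_law (alpha : R) (a : R -> R) : Prop :=
  forall t, 0 < t -> a t = Rpower t alpha.

Lemma power_law_pos (alpha : R) (a : R -> R) (t : R) :
  power_law alpha a -> 0 < t -> 0 < a t.
Proof. intros ha Ht. rewrite ha by assumption. apply Rpower_pos. Qed.

Lemma is_derive_power_law (alpha : R) (a : R -> R) (t : R) :
  power_law alpha a -> 0 < t -> is_derive a t (alpha / t * a t).
Proof.
  intros ha Ht. apply (is_derive_ext_loc (fun t => Rpower t alpha)).
  - exists (mkposreal _ Ht). intros y Hy. change (Rabs (y - t) < t) in Hy.
    apply Rabs_def2 in Hy. rewrite ha; [reflexivity|lra].
  - rewrite ha, <- (Rpower_minus_1 t alpha) by assumption.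
    replace (alpha / t * (t * Rpower t (alpha - 1)))
      with (alpha * Rpower t (alpha - 1)) by (field; lra).
    now apply is_derive_Rpower.
Qed.

Lemma Derive_power_law (alpha : R) (a : R -> R) (t : R) :
  power_law alpha a -> 0 < t -> Derive a t = alpha / t * a t.
Proof. intros. now apply is_derive_unique, is_derive_power_law. Qed.

(** The geodesic equation with [a' = alpha a / t] substituted, in a form ready for differentiating
    invariants. *)
Lemma is_geodesic_derive
  (alpha : R) (a : R -> R) (ha : power_law alpha a) (L : R) (c dc : R -> R * R) (s : R) :
  is_geodesic a L c dc -> 0 <= s <= L ->
  let t := fst (c s) in let u := fst (dc s) in let w := snd (dc s) in
  0 < t
  /\ is_derive (fun r => a (fst (c r))) s (alpha / t * a t * u)
  /\ is_derive (fun r => fst (dc r)) s (- (alpha / t * a t ^ 2 * w ^ 2))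
  /\ is_derive (fun r => snd (dc r)) s (- (2 * alpha / t * u * w)).
Proof.
  intros [Hc Hp] Hs t u w.
  destruct (Hc s Hs) as (Ht & Hd0 & Hd1). destruct (Hp s Hs) as (Hp0 & Hp1).
  fold t u w in Ht, Hd0, Hd1, Hp0, Hp1. generalize (power_law_pos _ _ _ ha Ht); intro Ha.
  unfold christoffel in Hp0, Hp1. simpl in Hp0, Hp1. fold t u w in Hp0, Hp1.
  rewrite (Derive_power_law alpha) in Hp0, Hp1 by assumption.
  split; [assumption|]. split; [|split].
  - evar_last.
    + apply (is_derive_comp a (fun r => fst (c r))); [|exact Hd0].
      now apply (is_derive_power_law alpha).
    + unfold scal; simpl; unfold mult; simpl. fold t. ring.
  - evar_last; [exact Hp0|]. ring.
  - evar_last; [exact Hp1|]. field. lra.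
Qed.

(* The unit vector orthogonal to the velocity of a geodesic is parallel. *)
Lemma is_parallel_combination
  (alpha : R) (a : R -> R) (ha : power_law alpha a) (L : R) (c dc : R -> R * R) (x y : R) :
  is_geodesic a L c dc ->
  is_parallel a L c dc (fun s =>
    (x * (a (fst (c s)) * snd (dc s)) + y * fst (dc s),
     x * (fst (dc s) / a (fst (c s))) + y * snd (dc s))).
Proof.
  intros Hgeo s Hs.
  destruct (is_geodesic_derive alpha a ha _ _ _ s Hgeo Hs) as (Ht & Da & Du & Dw).
  generalize (power_law_pos _ _ _ ha Ht); intro Ha.
  unfold christoffel; simpl.
  rewrite (Derive_power_law alpha) by assumption.
  set (t := fst (c s)) in *. set (u := fst (dc s)) in *. set (w := snd (dc s)) in *.
  split.
  - evar_last.
    + apply @is_derive_plus; apply is_derive_scal; [|exact Du].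
      apply (is_derive_mult (fun r => a (fst (c r))) (fun r => snd (dc r)));
        [exact Da|exact Dw|intros; apply Rmult_comm].
    + unfold plus, mult; simpl. fold t u w. field. lra.
  - evar_last.
    + apply @is_derive_plus; apply is_derive_scal; [|exact Dw].
      apply is_derive_div; [exact Du|exact Da|]. fold t. lra.
    + unfold plus, mult; simpl. fold t u w. field. lra.
Qed.

(** [Q2] pairs [X] with the velocity and [Q1] pairs it with the unit normal [(a w, u / a)], where
    [(u, w)] is the velocity. Both pairings are constant for parallel fields, and together they
    determine [X 0] from [X L]. *)
Lemma is_parallel_invariants
  (alpha : R) (a : R -> R) (ha : power_law alpha a) (L : R) (c dc X : R -> R * R) (s : R) :
  is_geodesic a L c dc -> is_parallel a L c dc X -> 0 <= s <= L ->
  let Q1 s := a (fst (c s)) * (snd (X s) * fst (dc s) - fst (X s) * snd (dc s)) in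
  let Q2 s := metric a (c s) (X s) (dc s) in
  Q1 0 = Q1 s /\ Q2 0 = Q2 s.
Proof.
  intros Hgeo HX [Hs0 HsL] Q1 Q2.
  destruct Hs0 as [Hs0|Hs0]; [|now rewrite Hs0].
  assert (H : forall r, 0 <= r <= s -> is_derive Q1 r 0 /\ is_derive Q2 r 0).
  { intros r Hr. assert (HrL : 0 <= r <= L) by lra.
    destruct (is_geodesic_derive alpha a ha _ _ _ r Hgeo HrL) as (Ht & Da & Du & Dw).
    generalize (power_law_pos _ _ _ ha Ht); intro Har.
    destruct (HX r HrL) as [D0 D1]. unfold christoffel in D0, D1; simpl in D0, D1.
    rewrite (Derive_power_law alpha) in D0, D1 by assumption.
    unfold Q1, Q2, metric.
    set (t := fst (c r)) in *. set (u := fst (dc r)) in *. set (w := snd (dc r)) in *.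
    set (X0 := fst (X r)) in *. set (X1 := snd (X r)) in *.
    split.
    - evar_last.
      + apply (is_derive_mult (fun r => a (fst (c r)))
          (fun r => snd (X r) * fst (dc r) - fst (X r) * snd (dc r)));
          [exact Da| |intros; apply Rmult_comm].
        apply @is_derive_minus;
          [apply (is_derive_mult (fun r => snd (X r)) (fun r => fst (dc r)))
          |apply (is_derive_mult (fun r => fst (X r)) (fun r => snd (dc r)))];
          first [exact D0|exact D1|exact Du|exact Dw|intros; apply Rmult_comm].
      + unfold minus, plus, opp, mult; simpl. fold t u w X0 X1. field. lra.
    - evar_last.
      + apply @is_derive_plus.
        * apply @is_derive_opp.
          apply (is_derive_mult (fun r => fst (X r)) (fun r => fst (dc r)));
          first [exact D0|exact Du|intros; apply Rmult_comm].
        * apply (is_derive_mult (fun r => a (fst (c r)) ^ 2)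
                   (fun r => snd (X r) * snd (dc r))); [| |intros; apply Rmult_comm].
          -- apply (is_derive_pow (fun r => a (fst (c r))) 2). exact Da.
          -- apply (is_derive_mult (fun r => snd (X r)) (fun r => snd (dc r)));
               first [exact D1|exact Dw|intros; apply Rmult_comm].
      + unfold plus, opp, mult; simpl. fold t u w X0 X1. field. lra. }
  split; apply (eq_is_derive (V := R_NormedModule)); try assumption;
    intros r Hr; now apply H.
Qed.

(** * The geodesics in terms of the angle psi *)

Definition geo_time (alpha tau psi : R) : R := tau * Rpower (cos psi) (/ alpha).
Definition geo_chi (alpha tau psi : R) : R :=
  Rpower tau (1 - alpha) / alpha * cosint (/ alpha - 2) psi.
Definition geo_length (alpha tau psi : R) : R := tau / alpha * cosint (/ alpha) psi.

Lemma geo_time_pos (alpha tau psi : R) : 0 < tau -> 0 < geo_time alpha tau psi.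
Proof. intro H. apply Rmult_lt_0_compat; [assumption|apply Rpower_pos]. Qed.

Lemma power_law_geo_time (alpha : R) (a : R -> R) (tau psi : R) :
  0 < alpha -> power_law alpha a -> 0 < tau -> 0 < cos psi ->
  a (geo_time alpha tau psi) = a tau * cos psi.
Proof.
  intros Hal ha Htau Hc. rewrite !ha; [|assumption|now apply geo_time_pos].
  unfold geo_time. rewrite <- Rpower_mult_distr; [|assumption|apply Rpower_pos].
  rewrite Rpower_mult, Rinv_l, Rpower_1 by lra. reflexivity.
Qed.

Lemma Rpower_minus_2 (x y : R) : 0 < x -> Rpower x (y - 2) = Rpower x y / x ^ 2.
Proof.
  intro Hx. rewrite <- (Rpower_minus_1 x y Hx), <- (Rpower_minus_1 x (y - 1) Hx).
  replace (y - 1 - 1) with (y - 2) by ring. field. lra.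
Qed.

(** Defining psi by [atan (- t')] rather than as an arccosine of [a t / a tau] keeps it
    differentiable at the starting point, where that ratio is 1, and makes [cos psi > 0]
    automatic. *)
Lemma fermi_geodesic_invariants (alpha : R) (a : R -> R) (tau chi L : R) (c dc : R -> R * R) :
  0 < alpha -> power_law alpha a -> 0 < tau ->
  fermi_geodesic a tau chi L c dc ->
  forall s, 0 <= s <= L ->
    let psi := atan (- fst (dc s)) in
    metric a (c s) (dc s) (dc s) = 1
    /\ snd (dc s) = / (a tau * cos psi ^ 2)
    /\ fst (c s) = geo_time alpha tau psi
    /\ snd (c s) = geo_chi alpha tau psi
    /\ s = geo_length alpha tau psi.
Proof.
  intros Hal ha Htau (HL & Hgeo & Hc0 & Hdc0 & HcL & Hlt).
  (* A geodesic of parameter length 0 would end at time [tau], not before it. *)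
  assert (HL' : 0 < L).
  { destruct HL as [HL|HL]; [assumption|]. rewrite <- HL, Hc0 in Hlt.
    simpl in Hlt. lra. }
  generalize (power_law_pos _ _ _ ha Htau); intro HA. set (A := a tau) in *.
  set (psi := fun s => atan (- fst (dc s))).
  assert (Hpsi : forall s, - (PI / 2) < psi s < PI / 2).
  { intro s. generalize (atan_bound (- fst (dc s))). unfold psi. lra. }
  assert (Hbase : forall s, 0 <= s <= L ->
    metric a (c s) (dc s) (dc s) = 1
    /\ 0 < cos (psi s)
    /\ snd (dc s) = / (A * cos (psi s) ^ 2)
    /\ a (fst (c s)) = A * cos (psi s)
    /\ fst (c s) = geo_time alpha tau (psi s)
    /\ 1 + fst (dc s) ^ 2 = / cos (psi s) ^ 2).
  { intros s Hs.
    destruct (is_geodesic_derive alpha a ha _ _ _ s Hgeo Hs) as (Ht & _).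
    generalize (power_law_pos _ _ _ ha Ht); intro Has.
    assert (Q2 : metric a (c s) (dc s) (dc s) = 1).
    { destruct (is_parallel_invariants alpha a ha L c dc dc s Hgeo (proj2 Hgeo) Hs)
        as [_ E].
      rewrite <- E, Hc0, Hdc0. unfold metric, S_vec; simpl. fold A. field. lra. }
    (* The momentum conjugate to chi, conserved because the metric does not depend on chi. *)
    assert (Q1 : a (fst (c s)) ^ 2 * snd (dc s) = A).
    { set (q := fun s => a (fst (c s)) ^ 2 * snd (dc s)).
      transitivity (q 0).
      2:{ unfold q. rewrite Hc0, Hdc0. simpl. fold A. field. lra. }
      symmetry. destruct (proj1 Hs) as [Hs0|Hs0]; [|now rewrite Hs0].
      apply (eq_is_derive (V := R_NormedModule) q); [|assumption].
      intros r Hr. assert (HrL : 0 <= r <= L) by lra.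
      destruct (is_geodesic_derive alpha a ha _ _ _ r Hgeo HrL) as (Htr & Da & _ & Dw).
      unfold q. evar_last.
      - apply (is_derive_mult (fun r => a (fst (c r)) ^ 2) (fun r => snd (dc r)));
          [|exact Dw|intros; apply Rmult_comm].
        apply (is_derive_pow (fun r => a (fst (c r))) 2). exact Da.
      - unfold plus, mult, zero; simpl. field. lra. }
    assert (Hcos : 0 < cos (psi s)) by apply cos_pos, Hpsi.
    assert (Hu : 1 + fst (dc s) ^ 2 = (A / a (fst (c s))) ^ 2).
    { rewrite <- Q1. unfold metric in Q2.
      replace (1 + fst (dc s) ^ 2) with (a (fst (c s)) ^ 2 * (snd (dc s) * snd (dc s))) by lra.
      field. lra. }
    assert (Hca : a (fst (c s)) = A * cos (psi s)).
    { unfold psi. rewrite cos_atan.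
      replace (1 + (- fst (dc s))²) with ((A / a (fst (c s)))²).
      2:{ unfold Rsqr. replace (- fst (dc s) * - fst (dc s)) with (fst (dc s) ^ 2) by ring.
          rewrite Hu. ring. }
      rewrite sqrt_Rsqr; [field; lra|]. left. now apply Rdiv_lt_0_compat. }
    repeat split; try assumption.
    - rewrite <- Q1, Hca. replace (snd (dc s)) with (A / a (fst (c s)) ^ 2).
      + rewrite Hca. field. lra.
      + rewrite <- Q1. field. lra.
    - unfold geo_time.
      replace (cos (psi s)) with (a (fst (c s)) / A) by (rewrite Hca; field; lra).
      unfold A. rewrite !ha by assumption.
      unfold Rdiv. rewrite <- Rpower_mult_distr;
        [|apply Rpower_pos|apply Rinv_0_lt_compat, Rpower_pos].
      rewrite <- Rpower_Ropp, !Rpower_mult, Rinv_r, Rpower_1 by lra.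
      replace (- alpha * / alpha) with (- (1)) by (field; lra).
      rewrite Rpower_Ropp, Rpower_1 by assumption. field. lra.
    - rewrite Hu, Hca. field. lra. }
  assert (Dpsi : forall s, 0 <= s <= L -> is_derive psi s (alpha / fst (c s))).
  { intros s Hs.
    destruct (is_geodesic_derive alpha a ha _ _ _ s Hgeo Hs) as (Ht & _ & Du & _).
    destruct (Hbase s Hs) as (Q & Hcos & Hw & Hca & _ & Hu).
    unfold psi. evar_last.
    - apply (is_derive_comp atan (fun s => - fst (dc s))).
      + apply is_derive_atan.
      + apply @is_derive_opp. exact Du.
    - unfold scal, opp; simpl. unfold mult; simpl.
      replace (1 + (- fst (dc s))²) with (1 + fst (dc s) ^ 2) by (unfold Rsqr; ring).
      rewrite Hu, Hw, Hca. field. lra. }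
  assert (Hpsi0 : psi 0 = 0).
  { unfold psi. rewrite Hdc0. simpl. rewrite Ropp_0. apply atan_0. }
  intros s Hs. fold (psi s).
  destruct (Hbase s Hs) as (Q & Hcos & Hw & Hca & Ht & _).
  repeat split; try assumption.
  (* The coordinate and its formula in psi have the same derivative, by [psi' = alpha / t], and
     agree at [s = 0]. The arc length is treated in the same way. *)
  - set (q := fun s => snd (c s) - geo_chi alpha tau (psi s)).
    assert (E : q 0 = q s).
    { destruct (proj1 Hs) as [Hs0|Hs0]; [|now rewrite Hs0].
      apply (eq_is_derive (V := R_NormedModule) q); [|assumption].
      intros r Hr. assert (HrL : 0 <= r <= L) by lra.
      destruct (Hbase r HrL) as (_ & Hcosr & Hwr & _ & Htr & _).
      destruct (proj1 Hgeo r HrL) as (Htpos & _ & Dchi).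
      unfold q. evar_last.
      - apply @is_derive_minus; [exact Dchi|].
        apply is_derive_scal.
        apply (is_derive_comp (cosint (/ alpha - 2)) psi).
        + now apply is_derive_cosint.
        + now apply Dpsi.
      - unfold minus, plus, opp, scal, zero; simpl. unfold mult; simpl.
        rewrite Hwr, Htr, Rpower_minus_2 by assumption. unfold geo_time, A.
        rewrite ha by assumption.
        replace (Rpower tau (1 - alpha)) with (tau / Rpower tau alpha).
        2:{ unfold Rminus. rewrite Rpower_plus, Rpower_Ropp, Rpower_1 by assumption.
            reflexivity. }
        generalize (Rpower_pos tau alpha) (Rpower_pos (cos (psi r)) (/ alpha)).
        intros P1 P2. field. repeat split; lra. }
    unfold q in E. rewrite Hc0, Hpsi0 in E. simpl in E. unfold geo_chi in E at 1.
    rewrite cosint_0 in E. lra.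
  - set (q := fun s => s - geo_length alpha tau (psi s)).
    assert (E : q 0 = q s).
    { destruct (proj1 Hs) as [Hs0|Hs0]; [|now rewrite Hs0].
      apply (eq_is_derive (V := R_NormedModule) q); [|assumption].
      intros r Hr. assert (HrL : 0 <= r <= L) by lra.
      destruct (Hbase r HrL) as (_ & Hcosr & _ & _ & Htr & _).
      unfold q. evar_last.
      - apply @is_derive_minus; [apply @is_derive_id|].
        apply is_derive_scal.
        apply (is_derive_comp (cosint (/ alpha)) psi).
        + now apply is_derive_cosint.
        + now apply Dpsi.
      - unfold minus, plus, opp, scal, zero, one; simpl. unfold mult; simpl.
        rewrite Htr. unfold geo_time.
        generalize (Rpower_pos (cos (psi r)) (/ alpha)).
        intro P2. field. repeat split; lra. }
    unfold q in E. rewrite Hpsi0 in E. unfold geo_length in E at 1.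
    rewrite cosint_0 in E. lra.
Qed.

Lemma Rpower_1_minus (x y : R) : 0 < x -> Rpower x (1 - y) = x / Rpower x y.
Proof.
  intro Hx. unfold Rminus. rewrite Rpower_plus, Rpower_Ropp, Rpower_1 by assumption.
  reflexivity.
Qed.

Lemma geo_length_inverse (alpha tau psi0 : R) :
  0 < alpha -> 0 < tau -> 0 < psi0 < PI / 2 ->
  exists psi, psi 0 = 0 /\ psi (geo_length alpha tau psi0) = psi0
    /\ forall s, 0 <= s <= geo_length alpha tau psi0 ->
       - (PI / 2) < psi s < PI / 2
       /\ is_derive psi s (alpha / geo_time alpha tau (psi s)).
Proof.
  intros Hal Htau Hpsi0.
  (* The inverse is taken on [[-b, b]], which contains both 0 and [psi0] in its interior, because
     [is_curve] asks for two-sided derivatives at the endpoints. *)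
  set (b := (psi0 + PI / 2) / 2).
  assert (Hinc : forall x y, - (PI / 2) < x -> x < y -> y < PI / 2 ->
            geo_length alpha tau x < geo_length alpha tau y).
  { intros x y Hx Hxy Hy. apply Rmult_lt_compat_l; [now apply Rdiv_lt_0_compat|].
    now apply cosint_increasing. }
  assert (Hinj : forall x y, - (PI / 2) < x < PI / 2 -> - (PI / 2) < y < PI / 2 ->
            geo_length alpha tau x = geo_length alpha tau y -> x = y).
  { intros x y Hx Hy E. destruct (Rtotal_order x y) as [h|[h|h]]; [|assumption|];
      apply Hinc in h; lra. }
  assert (H0 : geo_length alpha tau 0 = 0).
  { unfold geo_length. rewrite cosint_0. ring. }
  destruct (inverse_function (geo_length alpha tau)
    (fun x => tau / alpha * Rpower (cos x) (/ alpha)) (- b) b) as (g & Hg).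
  - unfold b; lra.
  - intros x Hx. apply is_derive_scal, is_derive_cosint. unfold b in Hx; lra.
  - intros x Hx. apply Rmult_lt_0_compat; [now apply Rdiv_lt_0_compat|apply Rpower_pos].
  - assert (Hrange : forall s, 0 <= s <= geo_length alpha tau psi0 ->
              geo_length alpha tau (- b) < s < geo_length alpha tau b).
    { intros s Hs.
      assert (geo_length alpha tau (- b) < geo_length alpha tau 0)
        by (apply Hinc; unfold b; lra).
      assert (geo_length alpha tau psi0 < geo_length alpha tau b)
        by (apply Hinc; unfold b; lra).
      lra. }
    assert (Hpos : geo_length alpha tau 0 < geo_length alpha tau psi0)
      by (apply Hinc; lra).
    exists g. split; [|split].
    + destruct (Hg 0) as (H1 & H2 & _); [apply Hrange; lra|].
      apply Hinj; [unfold b in H1; lra|lra|now rewrite H0].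
    + destruct (Hg (geo_length alpha tau psi0)) as (H1 & H2 & _); [apply Hrange; lra|].
      apply Hinj; [unfold b in H1; lra|lra|assumption].
    + intros s Hs. destruct (Hg s (Hrange s Hs)) as (H1 & H2 & H3).
      split; [unfold b in H1; lra|].
      replace (alpha / geo_time alpha tau (g s))
        with (/ (tau / alpha * Rpower (cos (g s)) (/ alpha))); [exact H3|].
      unfold geo_time. generalize (Rpower_pos (cos (g s)) (/ alpha)). intro.
      field. repeat split; lra.
Qed.

(** The explicit formulas in psi, reparametrized by arc length. *)
Lemma fermi_geodesic_exists (alpha : R) (a : R -> R) (tau psi0 : R) :
  0 < alpha -> power_law alpha a -> 0 < tau -> 0 < psi0 < PI / 2 ->
  exists c dc,
    fermi_geodesic a tau (geo_chi alpha tau psi0) (geo_length alpha tau psi0) c dc.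
Proof.
  intros Hal ha Htau Hpsi0.
  generalize (power_law_pos _ _ _ ha Htau); intro HA.
  destruct (geo_length_inverse alpha tau psi0 Hal Htau Hpsi0) as (psi & P0 & P1 & Hpsi).
  exists (fun s => (geo_time alpha tau (psi s), geo_chi alpha tau (psi s))).
  exists (fun s => (- tan (psi s), / (a tau * cos (psi s) ^ 2))).
  split; [|split; [split|split; [|split; [|split]]]]; simpl.
  - unfold geo_length. rewrite <- (Rmult_0_r (tau / alpha)).
    apply Rmult_le_compat_l; [left; now apply Rdiv_lt_0_compat|].
    rewrite <- (cosint_0 (/ alpha)). left. apply cosint_increasing; lra.
  - intros s Hs. simpl. destruct (Hpsi s Hs) as [Hr Hd].
    generalize (cos_pos _ Hr); intro Hcos.
    generalize (Rpower_pos (cos (psi s)) (/ alpha)); intro Hp.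
    split; [now apply geo_time_pos|split].
    + evar_last.
      * apply is_derive_scal.
        apply (is_derive_comp (fun x => Rpower (cos x) (/ alpha)) psi); [|exact Hd].
        now apply is_derive_Rpower_cos.
      * unfold scal; simpl; unfold mult; simpl. unfold geo_time, tan.
        rewrite <- (Rpower_minus_1 (cos (psi s)) (/ alpha)) by assumption.
        generalize (Rpower_pos (cos (psi s)) (/ alpha - 1)). intro.
        field. repeat split; lra.
    + evar_last.
      * apply is_derive_scal.
        apply (is_derive_comp (cosint (/ alpha - 2)) psi); [|exact Hd].
        now apply is_derive_cosint.
      * unfold scal; simpl; unfold mult; simpl.
        rewrite Rpower_minus_2 by assumption.
        unfold geo_time. rewrite ha, Rpower_1_minus by assumption.
        generalize (Rpower_pos tau alpha). intro. field. repeat split; lra.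
  - intros s Hs. simpl. destruct (Hpsi s Hs) as [Hr Hd].
    generalize (cos_pos _ Hr); intro Hcos.
    generalize (geo_time_pos alpha tau (psi s) Htau); intro Ht.
    generalize (sin2_cos2 (psi s)); unfold Rsqr; intro Hsc.
    unfold christoffel; simpl.
    rewrite (Derive_power_law alpha) by assumption.
    rewrite power_law_geo_time by assumption.
    split.
    + evar_last.
      * apply @is_derive_opp.
        apply (is_derive_comp tan psi); [|exact Hd].
        apply is_derive_tan. lra.
      * unfold scal, opp; simpl; unfold mult; simpl. unfold tan.
        replace (sin (psi s) / cos (psi s) * (sin (psi s) / cos (psi s) * 1) + 1)
          with ((sin (psi s) * sin (psi s) + cos (psi s) * cos (psi s)) / cos (psi s) ^ 2)
          by (field; lra).
        rewrite Hsc. field. repeat split; lra.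
    + evar_last.
      * apply (is_derive_comp (fun x => / (a tau * cos x ^ 2)) psi); [|exact Hd].
        instantiate (1 := 2 * sin (psi s) / (a tau * cos (psi s) ^ 3)).
        auto_derive.
        -- apply Rgt_not_eq. apply Rmult_lt_0_compat; [assumption|]. nra.
        -- field. lra.
      * unfold scal; simpl; unfold mult; simpl. unfold tan.
        field. repeat split; lra.
  - rewrite P0. unfold geo_time, geo_chi. rewrite cos_0, cosint_0, Rmult_0_r.
    f_equal. unfold Rpower. rewrite ln_1, Rmult_0_r, exp_0. ring.
  - rewrite P0, tan_0, cos_0. unfold S_vec. f_equal; [ring|]. f_equal. ring.
  - now rewrite P1.
  - rewrite P1. unfold geo_time. rewrite <- (Rmult_1_r tau) at 2.
    apply Rmult_lt_compat_l; [assumption|].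
    assert (Hc0 : 0 < cos psi0) by (apply cos_pos; lra).
    assert (Hc1 : cos psi0 < 1).
    { rewrite <- cos_0. apply cos_decreasing_1; lra. }
    apply ln_increasing in Hc1; [|assumption]. rewrite ln_1 in Hc1.
    assert (Hi : 0 < / alpha) by now apply Rinv_0_lt_compat.
    assert (He : / alpha * ln (cos psi0) < 0) by nra.
    apply exp_increasing in He. now rewrite exp_0 in He.
Qed.

(** The coordinate chi is strictly increasing in psi, so reaching the particle fixes the final
    angle, and with it every other datum at the endpoint. *)
Lemma fermi_geodesic_endpoint
  (alpha : R) (a : R -> R) (tau psi0 L : R) (c dc : R -> R * R) :
  0 < alpha -> power_law alpha a -> 0 < tau -> 0 < psi0 < PI / 2 ->
  fermi_geodesic a tau (geo_chi alpha tau psi0) L c dc ->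
  fst (c L) = geo_time alpha tau psi0
  /\ fst (dc L) = - tan psi0
  /\ snd (dc L) = / (a tau * cos psi0 ^ 2)
  /\ L = geo_length alpha tau psi0
  /\ proper_length a L c dc = L.
Proof.
  intros Hal ha Htau Hpsi0 Hf.
  generalize (fermi_geodesic_invariants _ _ _ _ _ _ _ Hal ha Htau Hf); intro Hinv.
  destruct Hf as (HL & _ & _ & _ & HcL & _).
  destruct (Hinv L) as (_ & Hw & Ht & Hchi & HLg); [lra|].
  assert (E : atan (- fst (dc L)) = psi0).
  { generalize (atan_bound (- fst (dc L))); intro Hb.
    rewrite HcL in Hchi. unfold geo_chi in Hchi.
    apply Rmult_eq_reg_l in Hchi.
    2:{ apply Rgt_not_eq, Rdiv_lt_0_compat; [apply Rpower_pos|assumption]. }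
    destruct (Rtotal_order (atan (- fst (dc L))) psi0) as [h|[h|h]]; [|assumption|];
      apply (cosint_increasing (/ alpha - 2)) in h; lra. }
  rewrite E in *. repeat split; try assumption.
  - rewrite <- E, tan_atan. ring.
  - unfold proper_length.
    rewrite (RInt_ext _ (fun _ => 1)).
    + rewrite RInt_const. unfold scal; simpl; unfold mult; simpl. ring.
    + intros s Hs. rewrite Rmin_left, Rmax_right in Hs by assumption.
      unfold gnorm. destruct (Hinv s) as (-> & _); [lra|]. apply sqrt_1.
Qed.

(** * Values of the Fermi and kinematic quantities *)

Lemma t_s_eq (alpha : R) (a : R -> R) (tau psi0 : R) :
  0 < alpha -> power_law alpha a -> 0 < tau -> 0 < psi0 < PI / 2 ->
  t_s a tau (geo_chi alpha tau psi0) = geo_time alpha tau psi0.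
Proof.
  intros Hal ha Htau Hpsi0. apply the_eq.
  - destruct (fermi_geodesic_exists alpha a tau psi0) as (c & dc & Hf); try assumption.
    exists (geo_length alpha tau psi0), c, dc. split; [assumption|].
    destruct (fermi_geodesic_endpoint alpha a tau psi0 (geo_length alpha tau psi0) c dc)
      as (E & _); auto.
  - intros t (L & c & dc & Hf & ->).
    destruct (fermi_geodesic_endpoint alpha a tau psi0 L c dc) as (E & _); auto.
Qed.

Lemma fermi_distance_eq (alpha : R) (a : R -> R) (tau psi0 : R) :
  0 < alpha -> power_law alpha a -> 0 < tau -> 0 < psi0 < PI / 2 ->
  fermi_distance a tau (geo_chi alpha tau psi0) = geo_length alpha tau psi0.
Proof.
  intros Hal ha Htau Hpsi0. apply the_eq.
  - destruct (fermi_geodesic_exists alpha a tau psi0) as (c & dc & Hf); try assumption.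
    exists (geo_length alpha tau psi0), c, dc. split; [assumption|].
    destruct (fermi_geodesic_endpoint alpha a tau psi0 (geo_length alpha tau psi0) c dc)
      as (_ & _ & _ & _ & E); auto.
  - intros t (L & c & dc & Hf & ->).
    destruct (fermi_geodesic_endpoint alpha a tau psi0 L c dc)
      as (_ & _ & _ & E1 & E2); auto. now rewrite E2.
Qed.

Lemma transported_velocity_eq (alpha : R) (a : R -> R) (tau psi0 : R) :
  0 < alpha -> power_law alpha a -> 0 < tau -> 0 < psi0 < PI / 2 ->
  transported_velocity a tau (geo_chi alpha tau psi0)
  = (/ cos psi0, tan psi0 / a tau).
Proof.
  intros Hal ha Htau Hpsi0.
  generalize (power_law_pos _ _ _ ha Htau); intro HA.
  assert (Hcos : 0 < cos psi0) by (apply cos_pos; lra).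
  assert (Hac : a (geo_time alpha tau psi0) = a tau * cos psi0)
    by now apply power_law_geo_time.
  generalize (sin2_cos2 psi0); unfold Rsqr; intro Hsc.
  assert (Hsc' : / cos psi0 * / cos psi0 - tan psi0 * tan psi0 = 1).
  { unfold tan.
    replace (_ - _) with ((1 - sin psi0 * sin psi0) / cos psi0 ^ 2) by (field; lra).
    replace (1 - sin psi0 * sin psi0) with (cos psi0 * cos psi0) by lra.
    field. lra. }
  apply the_eq.
  - destruct (fermi_geodesic_exists alpha a tau psi0) as (c & dc & Hf); try assumption.
    set (L := geo_length alpha tau psi0) in *.
    destruct (fermi_geodesic_endpoint alpha a tau psi0 L c dc) as (E1 & E2 & E3 & _); auto.
    (* In the parallel frame formed by the unit normal and the velocity, [d/dt] at the endpoint has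
       components [/ cos psi0] and [tan psi0]. At the start the frame is [d/dt] and [S_vec]. *)
    eexists L, c, dc, _. split; [exact Hf|].
    destruct Hf as (_ & Hgeo & Hc0 & Hdc0 & _).
    split; [exact (is_parallel_combination alpha a ha L c dc (/ cos psi0) (tan psi0) Hgeo)|].
    cbv beta. rewrite E1, E2, E3, Hac, Hc0, Hdc0. unfold four_velocity, S_vec; simpl.
    split; f_equal.
    + transitivity (/ cos psi0 * / cos psi0 - tan psi0 * tan psi0);
        [field; lra|exact Hsc'].
    + field. lra.
    + field. lra.
    + field. lra.
  - intros w (L & c & dc & X & Hf & HX & HXL & ->).
    destruct (fermi_geodesic_endpoint alpha a tau psi0 L c dc) as (E1 & E2 & E3 & _); auto.
    destruct Hf as (HL & Hgeo & Hc0 & Hdc0 & _).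
    (* At parameter 0 the invariant [Q1] reads off the time component of [X 0], up to sign, and [Q2]
       its spatial component. *)
    destruct (is_parallel_invariants alpha a ha L c dc X L Hgeo HX) as [Q1 Q2]; [lra|].
    rewrite Hc0, Hdc0, HXL, E1, E2, E3, Hac in Q1.
    unfold metric in Q2. rewrite Hc0, Hdc0, HXL, E1, E2, E3, Hac in Q2.
    unfold four_velocity, S_vec in Q1, Q2. simpl in Q1, Q2.
    rewrite (surjective_pairing (X 0)). f_equal.
    + replace (fst (X 0)) with (- (a tau * (snd (X 0) * 0 - fst (X 0) * / a tau)))
        by (field; lra).
      rewrite Q1. field. lra.
    + replace (snd (X 0)) with ((- (fst (X 0) * 0)
        + a tau * (a tau * 1) * (snd (X 0) * / a tau)) / a tau) by (field; lra).
      rewrite Q2. field. lra.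
Qed.

(** Orthogonality removes the time component of [V], so the scalar must be [/ cos psi0] and the
    speed is [tan psi0 * cos psi0]. *)
Lemma v_kin_eq (alpha : R) (a : R -> R) (tau psi0 : R) :
  0 < alpha -> power_law alpha a -> 0 < tau -> 0 < psi0 < PI / 2 ->
  v_kin a tau (geo_chi alpha tau psi0) = (0, sin psi0 / a tau).
Proof.
  intros Hal ha Htau Hpsi0.
  generalize (power_law_pos _ _ _ ha Htau); intro HA.
  assert (Hcos : 0 < cos psi0) by (apply cos_pos; lra).
  unfold v_kin. rewrite (transported_velocity_eq alpha) by assumption.
  unfold metric, four_velocity. apply the_eq.
  - simpl. split; [ring|]. exists (/ cos psi0).
    unfold scal, plus; simpl. unfold prod_scal, prod_plus, scal, plus; simpl.
    unfold mult; simpl. unfold tan. f_equal; field; lra.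
  - intros [V0 V1] [HV (gam & Hgam)]. simpl in HV.
    unfold scal, plus in Hgam; simpl in Hgam.
    unfold prod_scal, prod_plus, scal, plus in Hgam; simpl in Hgam.
    unfold mult in Hgam; simpl in Hgam.
    injection Hgam as H0 H1.
    assert (HV0 : V0 = 0) by lra. rewrite HV0, Rplus_0_r, Rmult_1_r in H0.
    f_equal; [assumption|]. rewrite Rplus_0_l, <- H0 in H1.
    apply (Rmult_eq_reg_l (/ cos psi0)); [|apply Rinv_neq_0_compat; lra].
    rewrite <- H1. unfold tan. field. lra.
Qed.

(** The reduction formula at exponent [/ alpha - 2] ties arc length to coordinate distance; it
    reconciles the two expressions for the Fermi speed. *)
Lemma geo_length_parts (alpha tau psi : R) :
  0 < alpha -> - (PI / 2) < psi < PI / 2 ->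
  geo_length alpha tau psi
  = tau * (Rpower (cos psi) (/ alpha - 1) * sin psi
           + (1 - alpha) / alpha * cosint (/ alpha - 2) psi).
Proof.
  intros Hal Hpsi. unfold geo_length.
  generalize (cosint_parts (/ alpha - 2) psi Hpsi).
  replace (/ alpha - 2 + 2) with (/ alpha) by ring.
  replace (/ alpha - 2 + 1) with (/ alpha - 1) by ring.
  intro E.
  replace (tau / alpha * cosint (/ alpha) psi)
    with (tau * (/ alpha * cosint (/ alpha) psi)) by (field; lra).
  rewrite E. field. lra.
Qed.

Lemma is_derive_fermi_distance (alpha : R) (a : R -> R) (tau psi0 : R) :
  0 < alpha -> power_law alpha a -> 0 < tau -> 0 < psi0 < PI / 2 ->
  is_derive (fun tau' => fermi_distance a tau' (geo_chi alpha tau psi0)) tau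
    (geo_length alpha tau psi0 / tau
     - (1 - alpha) / alpha * cos psi0 ^ 2 * cosint (/ alpha - 2) psi0).
Proof.
  intros Hal ha Htau Hpsi0.
  assert (Hcos : 0 < cos psi0) by (apply cos_pos; lra).
  set (m := / alpha - 2). set (chi := geo_chi alpha tau psi0).
  set (b := (psi0 + PI / 2) / 2).
  destruct (inverse_function (cosint m) (fun x => Rpower (cos x) m) 0 b) as (g & Hg).
  { unfold b; lra. }
  { intros x Hx. apply is_derive_cosint. unfold b in Hx; lra. }
  { intros; apply Rpower_pos. }
  assert (Hrange : 0 < cosint m psi0 < cosint m b).
  { split; [rewrite <- (cosint_0 m)|]; apply cosint_increasing; unfold b; lra. }
  (* [nu t] is the value of [v] at central proper time [t] with chi fixed; the endpoint angle at
     that time is [g (nu t)]. *)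
  set (nu := fun t => alpha * chi * Rpower t (alpha - 1)).
  assert (Hnu0 : nu tau = cosint m psi0).
  { unfold nu, chi, geo_chi. fold m.
    replace (alpha - 1) with (- (1 - alpha)) by ring. rewrite Rpower_Ropp.
    generalize (Rpower_pos tau (1 - alpha)). intro. field. lra. }
  assert (Hdnu : is_derive nu tau ((alpha - 1) * cosint m psi0 / tau)).
  { unfold nu. evar_last; [apply is_derive_scal; now apply is_derive_Rpower|].
    rewrite <- Hnu0. unfold nu. rewrite <- (Rpower_minus_1 tau (alpha - 1)) by assumption.
    field. lra. }
  assert (Hg0 : g (nu tau) = psi0).
  { rewrite Hnu0. destruct (Hg (cosint m psi0)) as (H1 & H2 & _); [rewrite cosint_0; lra|].
    unfold b in H1.
    destruct (Rtotal_order (g (cosint m psi0)) psi0) as [h|[h|h]]; [|assumption|];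
      apply (cosint_increasing m) in h; lra. }
  (* The formula for the distance is needed on a neighbourhood of [tau]; continuity of [nu] keeps it
     in the domain of [g] there. *)
  apply (is_derive_ext_loc (fun t => geo_length alpha t (g (nu t)))).
  { assert (Hloc : locally tau (fun t => 0 < nu t < cosint m b)).
    { assert (Hcont : continuous nu tau).
      { apply (@ex_derive_continuous R_AbsRing R_NormedModule). eexists; exact Hdnu. }
      apply (Hcont (fun y => 0 < y < cosint m b)). rewrite Hnu0.
      apply (locally_interval _ _ 0 (cosint m b)); simpl; try lra. auto. }
    apply (filter_imp (fun t => 0 < t /\ 0 < nu t < cosint m b)).
    - intros t [Ht Hnu].
      destruct (Hg (nu t)) as (H1 & H2 & _); [rewrite cosint_0; lra|].
      replace chi with (geo_chi alpha t (g (nu t))).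
      + rewrite (fermi_distance_eq alpha); auto. unfold b in H1; lra.
      + unfold geo_chi. fold m. rewrite H2. unfold nu.
        replace (alpha - 1) with (- (1 - alpha)) by ring. rewrite Rpower_Ropp.
        generalize (Rpower_pos t (1 - alpha)). intro. field. lra.
    - apply filter_and; [|exact Hloc].
      apply (locally_interval _ _ 0 p_infty); simpl; auto. }
  unfold geo_length. evar_last.
  - apply (is_derive_mult (fun t => t / alpha) (fun t => cosint (/ alpha) (g (nu t)))).
    + instantiate (1 := / alpha). auto_derive; [trivial|]. field. lra.
    + apply (is_derive_comp (cosint (/ alpha)) (fun t => g (nu t))).
      * apply is_derive_cosint. rewrite Hg0. lra.
      * apply (is_derive_comp g nu); [|exact Hdnu].
        apply Hg. rewrite Hnu0, cosint_0. lra.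
    + intros; apply Rmult_comm.
  - rewrite Hg0. unfold plus, scal; simpl; unfold mult; simpl.
    (* The chain rule produces [cos^(1/alpha) / cos^(1/alpha - 2)], which is the factor [cos^2]. *)
    unfold m at 2. rewrite Rpower_minus_2 by assumption.
    generalize (Rpower_pos (cos psi0) (/ alpha)). intro. field. lra.
Qed.

Lemma v_Fermi_eq (a : R -> R) (tau chi d : R) :
  is_derive (fun tau' => fermi_distance a tau' chi) tau d ->
  v_Fermi a tau chi = scal d (S_vec a tau).
Proof.
  intro Hd. apply the_eq.
  - now exists d.
  - intros V (d' & Hd' & ->). f_equal.
    apply is_derive_unique in Hd. apply is_derive_unique in Hd'. congruence.
Qed.

Lemma gnorm_spatial (a : R -> R) (tau x : R) :
  0 < a tau -> 0 <= x -> gnorm a (tau, 0) (0, x / a tau) = x.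
Proof.
  intros Ha Hx. unfold gnorm, metric. simpl.
  replace (_ + _) with (x * x) by (field; lra). now apply sqrt_square.
Qed.

(** * The inverse of [F_alpha] *)

(** With [b = (1 - alpha) / (2 alpha)] the hypergeometric parameters are [1/2, b, b + 1], the
    prefactor is [z^(2 b)], and the cosine exponent [2 b - 1] is [/ alpha - 2]. *)
Lemma Falpha_cos (alpha : R) :
  0 < alpha < 1 ->
  is_wallis (/ alpha - 2) (alpha / (1 - alpha) * Calpha alpha)
  /\ forall x, 0 < x < PI / 2 ->
     Falpha alpha (cos x) = Calpha alpha - (1 - alpha) / alpha * cosint (/ alpha - 2) x.
Proof.
  intro Hal. set (b := (1 - alpha) / (2 * alpha)).
  assert (Hb : 0 < b) by (apply Rdiv_lt_0_compat; lra).
  destruct (hyp2F1_cosint b Hb) as [W HF].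
  unfold Falpha, Calpha.
  replace ((1 + alpha) / (2 * alpha)) with (b + 1) by (unfold b; field; lra).
  replace (1 / (2 * alpha)) with (b + 1 / 2) by (unfold b; field; lra).
  replace ((1 - alpha) / alpha) with (2 * b) by (unfold b; field; lra).
  replace (/ alpha - 2) with (2 * b - 1) by (unfold b; field; lra).
  split; [|exact HF].
  assert (Hg : 0 < Gamma (b + 1 / 2)) by (apply Gamma_pos; lra).
  replace (alpha / (1 - alpha) * _) with
    (sqrt PI * Gamma (b + 1) / Gamma (b + 1 / 2) / (2 * b)); [exact W|].
  replace (alpha / (1 - alpha)) with (/ (2 * b)) by (unfold b; field; lra).
  field. lra.
Qed.

Lemma Galpha_cosint (alpha psi0 : R) :
  0 < alpha < 1 -> 0 < psi0 < PI / 2 ->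
  Galpha alpha (cosint (/ alpha - 2) psi0) = Rpower (cos psi0) (/ alpha).
Proof.
  intros Hal Hpsi0. destruct (Falpha_cos alpha Hal) as [_ HF].
  unfold Galpha. replace (1 / alpha) with (/ alpha) by (field; lra). f_equal.
  apply the_eq.
  - split; [|now apply HF]. split; [apply cos_pos; lra|].
    rewrite <- cos_0. apply cos_decreasing_1; lra.
  - intros z [Hz Ez].
    (* Any competing preimage is written as the cosine of an acute angle, so uniqueness reduces to
       injectivity of [cosint]. *)
    assert (Hac : 0 < acos z < PI / 2).
    { assert (Hz' : -1 < z < 1) by lra.
      generalize (acos_bound_lt z Hz'); intro Hb. split; [lra|].
      apply Rnot_le_lt. intro h.
      assert (Hc : cos (acos z) <= 0) by (apply cos_le_0; lra).
      rewrite cos_acos in Hc; lra. }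
    rewrite <- (cos_acos z) in Ez |- * by lra. rewrite HF in Ez by assumption.
    f_equal.
    assert (E : cosint (/ alpha - 2) (acos z) = cosint (/ alpha - 2) psi0).
    { assert (0 < (1 - alpha) / alpha) by (apply Rdiv_lt_0_compat; lra).
      apply (Rmult_eq_reg_l ((1 - alpha) / alpha)); lra. }
    destruct (Rtotal_order (acos z) psi0) as [h|[h|h]]; [|assumption|];
      apply (cosint_increasing (/ alpha - 2)) in h; lra.
Qed.

Theorem proposition4p1
  (alpha : R) (halpha : 0 < alpha < 1)
  (a : R -> R) (ha : forall t, 0 < t -> a t = Rpower t alpha)
  (tau : R) (htau : 0 < tau)
  (chi : R) (hchi : 0 < chi)
  (v : R) (hv : v = alpha * chi / Rpower tau (1 - alpha))
  (hv_range : 0 < v < alpha / (1 - alpha) * Calpha alpha) :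
  let G := Galpha alpha v in
  let p := (tau, 0) in
  (gnorm a p (v_kin a tau chi)
     = sqrt (1 - Rpower (t_s a tau chi) (2 * alpha) / Rpower tau (2 * alpha))
   /\ gnorm a p (v_kin a tau chi) = sqrt (1 - Rpower G (2 * alpha)))
  /\
  (gnorm a p (v_Fermi a tau chi)
     = Rpower G (1 - alpha) * sqrt (1 - Rpower G (2 * alpha))
       + (1 - alpha) / alpha * (1 - Rpower G (2 * alpha)) * v
   /\ gnorm a p (v_Fermi a tau chi)
     = fermi_distance a tau chi / tau
       - (1 - alpha) / alpha * Rpower G (2 * alpha) * v).
Proof.
  intros G p.
  destruct (cosint_surjective (/ alpha - 2) (alpha / (1 - alpha) * Calpha alpha) v)
    as (psi & Hpsi & Hv).
  { now apply Falpha_cos. }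
  { assumption. }
  assert (Hchi : chi = geo_chi alpha tau psi).
  { unfold geo_chi. rewrite Hv, hv. generalize (Rpower_pos tau (1 - alpha)). intro.
    field. lra. }
  assert (Hal : 0 < alpha) by lra.
  generalize (power_law_pos _ _ _ ha htau); intro HA.
  assert (Hcos : 0 < cos psi) by (apply cos_pos; lra).
  assert (Hsin : 0 < sin psi) by (apply sin_gt_0; lra).
  generalize (sin2_cos2 psi); unfold Rsqr; intro Hsc.
  assert (HG : G = Rpower (cos psi) (/ alpha)).
  { unfold G. rewrite <- Hv. now apply Galpha_cosint. }
  assert (HG2 : Rpower G (2 * alpha) = cos psi ^ 2).
  { rewrite HG, Rpower_mult. replace (/ alpha * (2 * alpha)) with (INR 2) by (simpl; field; lra).
    now apply Rpower_pow. }
  assert (HG1 : Rpower G (1 - alpha) = Rpower (cos psi) (/ alpha - 1)).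
  { rewrite HG, Rpower_mult. f_equal. field. lra. }
  assert (Hsqrt : sqrt (1 - cos psi ^ 2) = sin psi).
  { replace (1 - cos psi ^ 2) with (sin psi * sin psi) by (rewrite <- Hsc; ring).
    apply sqrt_square. lra. }
  rewrite HG2, HG1, Hsqrt, Hchi.
  split.
  - rewrite (v_kin_eq alpha), (t_s_eq alpha) by assumption.
    unfold p. rewrite gnorm_spatial by lra. split; [|reflexivity].
    rewrite <- Hsqrt. f_equal. f_equal. unfold geo_time.
    rewrite <- Rpower_mult_distr by (try apply Rpower_pos; assumption).
    rewrite <- HG, HG2. generalize (Rpower_pos tau (2 * alpha)). intro. field. lra.
  - rewrite (v_Fermi_eq _ _ _ _
      (is_derive_fermi_distance alpha a tau psi Hal ha htau Hpsi)).
    rewrite (fermi_distance_eq alpha), Hv by assumption.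
    set (d := geo_length alpha tau psi / tau
              - (1 - alpha) / alpha * cos psi ^ 2 * v).
    assert (Ed : d = Rpower (cos psi) (/ alpha - 1) * sin psi
                     + (1 - alpha) / alpha * (1 - cos psi ^ 2) * v).
    { unfold d. rewrite geo_length_parts, Hv by lra. field. lra. }
    (* The norm gives the absolute value of the derivative; the first expression shows its sign,
       being a sum of nonnegative terms. *)
    assert (Hd : 0 <= d).
    { rewrite Ed. apply Rplus_le_le_0_compat.
      - apply Rmult_le_pos; [left; apply Rpower_pos|lra].
      - apply Rmult_le_pos; [apply Rmult_le_pos|].
        + left. apply Rdiv_lt_0_compat; lra.
        + replace (1 - cos psi ^ 2) with (sin psi * sin psi) by (rewrite <- Hsc; ring).
          nra.
        + lra. }
    replace (scal d (S_vec a tau)) with (0, d / a tau).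
    2:{ unfold scal, S_vec; simpl. unfold prod_scal, scal; simpl. unfold mult; simpl.
        f_equal. ring. }
    unfold p. rewrite gnorm_spatial by assumption.
    split; [exact Ed|reflexivity].
Qed.
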